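(* Let $G$ be a locally compact abelian metric group with Haar measure $\lambda$, $\lambda(G)<\infty$, and let $\hat G$ be its dual. Let $1<p_i<\infty$, $p_i'=\frac{p_i}{p_i-1}$ $(i=1,2,3)$, $\theta\ge 0$, and let $m\in BM_\theta[(p_1';(p_2';(p_3']$. Then: (a) For each $(s_0,t_0)\in\hat G\times\hat G$, the function $T_{(s_0,t_0)}m(s,t)=m(s-s_0,t-t_0)$ belongs to $BM_\theta[(p_1';(p_2';(p_3']$ and $\|T_{(s_0,t_0)}m\|_{[(p_1';(p_2';(p_3']_\theta}=\|m\|_{[(p_1';(p_2';(p_3']_\theta}$. (b) For each $(s_0,t_0)\in G\times G$, the function $M^2_{t_0}M^1_{s_0}m$ belongs to $BM_\theta[(p_1';(p_2';(p_3']$ and $\|M^2_{t_0}M^1_{s_0}m\|_{[(p_1';(p_2';(p_3']_\theta}=\|m\|_{[(p_1';(p_2';(p_3']_\theta}$, where $M^1_{s_0}m(s,t)=\langle s,s_0\rangle m(s,t)$ and $M^2_{t_0}m(s,t)=\langle t,t_0\rangle m(s,t)$.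
   Context: Setting: since $\lambda(G)<\infty$, $G$ is compact and $\hat G$ is countable and discrete; the Haar measure $\mu$ on $\hat G$ is counting measure, and $\lambda$ is normalized so that $\mu$ is its dual measure (i.e. $\lambda(G)=1$). $\langle s,x\rangle$ is the value of the character $s\in\hat G$ at $x\in G$, and $\hat f(s)=\int_G f(x)\langle s,-x\rangle\,d\lambda(x)$ for $f\in L^1(G)$. $C^\infty(G)$ is the space of infinitely differentiable complex functions on $G$ in the sense of Bruhat, i.e. functions $F\circ\pi$ with $\pi:G\to G/H$ the quotient by a closed subgroup $H$ such that $G/H$ is a Lie group and $F$ is smooth on $G/H$. Small Lebesgue space: for $1<p<\infty$, $p'=\frac{p}{p-1}$, $\theta\ge 0$, $L^{(p',\theta}(G)$ is the space of measurable complex functions $g$ with $$\|g\|_{(p',\theta}=\inf_{g=\sum_{k=1}^\infty g_k}\ \sum_{k=1}^\infty\ \inf_{0<\varepsilon<p-1}\varepsilon^{-\frac{\theta}{p-\varepsilon}}\Big(\int_G|g_k|^{(p-\varepsilon)'}d\lambda\Big)^{\frac1{(p-\varepsilon)'}}<\infty,$$ the outer infimum being over all decompositions of $g$ (a.e.) into series of a.e. finite measurable functions $g_k$, and $(p-\varepsilon)'=\frac{p-\varepsilon}{p-\varepsilon-1}$. Bilinear multipliers: for bounded measurable $m$ on $\hat G\times\hat G$ and $f,g\in C^\infty(G)$ put $B_m(f,g)(x)=\sum_{s\in\hat G}\sum_{t\in\hat G}\hat f(s)\hat g(t)m(s,t)\langle s+t,x\rangle$. Then $m\in BM_\theta[(p_1';(p_2';(p_3']$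 if there is $C>0$ with $\|B_m(f,g)\|_{(p_3',\theta}\le C\|f\|_{(p_1',\theta}\|g\|_{(p_2',\theta}$ for all $f,g\in C^\infty(G)$ (so that $B_m$ extends to a bounded bilinear operator $L^{(p_1',\theta}(G)\times L^{(p_2',\theta}(G)\to L^{(p_3',\theta}(G)$); $\|m\|_{[(p_1';(p_2';(p_3']_\theta}=\|B_m\|$ is the least such $C$. *)

(* Defs.v *)
From HB Require Import structures.
From mathcomp Require Import all_boot all_order all_algebra.
From mathcomp Require Import ring_quotient complex.
From mathcomp Require Import all_classical all_reals all_analysis.
From mathcomp Require summability.
Set Implicit Arguments.
Unset Strict Implicit.
Unset Printing Implicit Defensive.
Import Order.TTheory GRing.Theory Num.Theory.
Import numFieldNormedType.Exports.
Local Open Scope classical_set_scope.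
Local Open Scope ring_scope.

HB.instance Definition _ (R : realType) := NormedModule.copy R[i] R[i]^o.

Definition metrizable (R : realType) (T : topologicalType) : Prop :=
  exists d : T -> T -> R,
    [/\ forall x y, d x y = 0 <-> x = y,
        forall x y, d x y = d y x,
        forall x y z, d x z <= d x y + d y z &
        forall x (A : set T), nbhs x A <->
          exists2 e : R, 0 < e & [set y | d x y < e] `<=` A].

Definition borel (G : topologicalZmodType) : Type := G.

Section borel.
Variable G : topologicalZmodType.
HB.instance Definition _ := TopologicalZmodule.on (borel G).
HB.instance Definition _ := isPointed.Build (borel G) (0 : G).
Let borelT := g_sigma_algebraType (open : set (set (borel G))).
HB.instance Definition _ := Measurable.copy (borel G) borelT.
End borel.

Section haar.
Variables (R : realType) (G : topologicalZmodType).
Implicit Types (lambda : {measure set (borel G) -> \bar R}) (A : set G).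

Definition haar_measure lambda : Prop :=
  [/\ lambda [set: G] != 0%E,
      forall (x : G) A, measurable (A : set (borel G)) ->
        lambda [set x + y | y in A] = lambda A,
      forall K : set G, compact K -> (lambda K < +oo)%E,
      forall A, measurable (A : set (borel G)) ->
        lambda A = ereal_inf [set lambda U | U in [set U | open U /\ A `<=` U]] &
      forall U : set G, open U ->
        lambda U = ereal_sup [set lambda K | K in [set K | compact K /\ K `<=` U]]].

End haar.

Section dual.
Variables (R : realType) (G : topologicalZmodType).

Definition is_character (chi : G -> R[i]) : Prop :=
  [/\ continuous chi,
      forall x y, chi (x + y) = chi x * chi y &
      forall x, `|chi x| = 1].

(* Written additively; the coercion gives <s, x> as [s x]. *)
Record dual_group := DualGroup {
  character_fun :> G -> R[i];
  characterP : is_character character_fun }.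

Lemma dual_group_inj (s t : dual_group) : s =1 t -> s = t.
Proof.
case: s t => [s sP] [t tP] /= /funext st; rewrite -st in tP *.
by congr DualGroup; exact: Prop_irrelevance.
Qed.

Lemma character0 (s : dual_group) : s 0 = 1.
Proof.
have [_ sD s1] := characterP s.
have s0 : s 0 != 0 by rewrite -normr_gt0 s1.
by apply: (mulfI s0); rewrite mulr1 -sD addr0.
Qed.

HB.instance Definition _ := gen_eqMixin dual_group.
HB.instance Definition _ := gen_choiceMixin dual_group.

Lemma dual_zero_subproof : is_character (fun=> 1).
Proof.
split; [by move=> x; exact: cvg_cst|by move=> *; rewrite mulr1|].
by move=> x; rewrite normr1.
Qed.

Lemma dual_opp_subproof (s : dual_group) : is_character (fun x => s (- x)).
Proof.
have [sC sD s1] := characterP s; split; last by move=> x; exact: s1.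
  by move=> x; apply: (@continuous_comp _ _ _ (fun x => - x) s);
    [exact: opp_continuous|exact: sC].
by move=> x y; rewrite opprD sD.
Qed.

Lemma dual_add_subproof (s t : dual_group) : is_character (fun x => s x * t x).
Proof.
have [sC sD s1] := characterP s; have [tC tD t1] := characterP t.
split => [x|x y|x]; last by rewrite normrM s1 t1 mulr1.
  by apply: cvgM; [exact: sC|exact: tC].
by rewrite sD tD mulrACA.
Qed.

Definition dual_zero := DualGroup dual_zero_subproof.
Definition dual_opp s := DualGroup (dual_opp_subproof s).
Definition dual_add s t := DualGroup (dual_add_subproof s t).

Lemma dual_addA : associative dual_add.
Proof. by move=> s t u; apply: dual_group_inj => x /=; rewrite mulrA. Qed.

Lemma dual_addC : commutative dual_add.
Proof. by move=> s t; apply: dual_group_inj => x /=; rewrite mulrC. Qed.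

Lemma dual_add0 : left_id dual_zero dual_add.
Proof. by move=> s; apply: dual_group_inj => x /=; rewrite mul1r. Qed.

Lemma dual_addN : left_inverse dual_zero dual_opp dual_add.
Proof.
move=> s; apply: dual_group_inj => x /=; have [_ sD _] := characterP s.
by rewrite -sD addNr character0.
Qed.

HB.instance Definition _ :=
  GRing.isZmodule.Build dual_group dual_addA dual_addC dual_add0 dual_addN.

End dual.

Section smooth.
Variable R : realType.

Fixpoint Ck (n k : nat) (U : set 'rV[R]_n) (f : 'rV[R]_n -> R) : Prop :=
  (forall x, U x -> {for x, continuous f}) /\
  if k is k'.+1 then
    forall i : 'I_n, (forall x, U x -> derivable f x (delta_mx 0 i)) /\
                     Ck k' U (fun x => 'D_(delta_mx 0 i) f x)
  else True.

Definition smooth_on (n : nat) (U : set 'rV[R]_n) (f : 'rV[R]_n -> R) : Prop :=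
  open U /\ forall k, Ck k U f.

Definition smooth_map_on (n p : nat) (U : set 'rV[R]_n)
    (f : 'rV[R]_n -> 'rV[R]_p) : Prop :=
  open U /\ forall j : 'I_p, smooth_on U (fun x => f x 0 j).

End smooth.

Section lie.
Variables (R : realType) (Q : PreTopologicalZmodule.type).

(* Only the values of [chart_map] on [chart_dom] and those of [chart_inv] on
   the image of [chart_dom] matter. *)
Record chart (n : nat) := Chart {
  chart_dom : set Q;
  chart_map : Q -> 'rV[R]_n;
  chart_inv : 'rV[R]_n -> Q }.

Definition chart_img n (c : chart n) : set 'rV[R]_n :=
  [set chart_map c x | x in chart_dom c].

Definition is_chart n (c : chart n) : Prop :=
  [/\ open (chart_dom c), open (chart_img c),
      forall x, chart_dom c x -> chart_inv c (chart_map c x) = x,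
      forall x, chart_dom c x -> {for x, continuous (chart_map c)} &
      forall u, chart_img c u -> {for u, continuous (chart_inv c)}].

Definition smooth_atlas n (A : set (chart n)) : Prop :=
  [/\ forall c, A c -> is_chart c,
      forall x, exists2 c, A c & chart_dom c x &
      forall c d, A c -> A d ->
        smooth_map_on [set u | chart_img c u /\ chart_dom d (chart_inv c u)]
          (fun u => chart_map d (chart_inv c u))].

(* [A] makes the topological group [Q] a Lie group of dimension [n]; the group
   operations are read in the charts, with R^n x R^n encoded as R^(n + n). Second
   countability is not asked for: it is automatic when [Q] is compact. *)
Definition lie_group n (A : set (chart n)) : Prop :=
  [/\ hausdorff_space Q, smooth_atlas A,
      forall c d e, A c -> A d -> A e ->
        smooth_map_on
          [set w : 'rV[R]_(n + n) |
             [/\ chart_img c (lsubmx w), chart_img d (rsubmx w) &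
                 chart_dom e (chart_inv c (lsubmx w) + chart_inv d (rsubmx w))]]
          (fun w => chart_map e
                      (chart_inv c (lsubmx w) + chart_inv d (rsubmx w))) &
      forall c e, A c -> A e ->
        smooth_map_on [set u | chart_img c u /\ chart_dom e (- chart_inv c u)]
          (fun u => chart_map e (- chart_inv c u))].

Definition smooth_function n (A : set (chart n)) (F : Q -> R[i]) : Prop :=
  forall c, A c ->
    smooth_on (chart_img c) (fun u => complex.Re (F (chart_inv c u))) /\
    smooth_on (chart_img c) (fun u => complex.Im (F (chart_inv c u))).

End lie.

Definition quotient_group (G : topologicalZmodType) (H : zmodClosed G) : Type :=
  quotient_topology (Quotient.quot H).

Section quotient_group.
Variables (G : topologicalZmodType) (H : zmodClosed G).
Local Notation Q := (quotient_group H).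
HB.instance Definition _ := Topological.on Q.
HB.instance Definition _ := Quotient.on Q.
HB.instance Definition _ := GRing.isZmodule.Build Q
  (@Quotient.addqA _ H) (@Quotient.addqC _ H)
  (@Quotient.add0q _ H) (@Quotient.addNq _ H).
End quotient_group.

(* A Lie group structure inducing a given group topology is unique, so the
   existential over [A] only says that G / H is a Lie group. *)
Definition bruhat_smooth (R : realType) (G : topologicalZmodType)
    (f : G -> R[i]) : Prop :=
  exists H : zmodClosed G, closed [set x : G | x \in H] /\
  exists (n : nat) (A : set (chart R (quotient_group H) n)), lie_group A /\
  exists F : quotient_group H -> R[i], smooth_function A F /\
    forall x : G, f x = F (\pi_(quotient_group H) x)%qT.

Definition conj_exp (R : realType) (p : R) : R := p / (p - 1).

Section multipliers.
Variables (R : realType) (G : topologicalZmodType).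
Variable lambda : {measure set (borel G) -> \bar R}.
Local Notation dual := (dual_group R G).

Definition cmeasurable (g : G -> R[i]) : Prop :=
  measurable_fun [set: borel G] (fun x : borel G => complex.Re (g x)) /\
  measurable_fun [set: borel G] (fun x : borel G => complex.Im (g x)).

Definition cintegral (g : G -> R[i]) : R[i] :=
  Complex (Rintegral lambda setT (fun x : borel G => complex.Re (g x)))
          (Rintegral lambda setT (fun x : borel G => complex.Im (g x))).

(* [complex.Re `|z|] is the modulus of [z] as a real number. *)
Definition small_term (p theta : R) (g : G -> R[i]) : \bar R :=
  ereal_inf [set ((eps `^ (- (theta / (p - eps))))%:E *
      Lnorm lambda (conj_exp (p - eps))%:E
        (fun x : borel G => (complex.Re `|g x|)%:E))%E
    | eps in [set eps : R | 0 < eps < p - 1]].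

(* The indices [p] below are those of the spaces L^(p', theta; the norm is +oo
   outside the space. *)
Definition small_norm (p theta : R) (g : G -> R[i]) : \bar R :=
  ereal_inf [set (\sum_(0 <= k <oo) small_term p theta (gs k))%E
    | gs in [set gs : nat -> G -> R[i] |
        (forall k, cmeasurable (gs k)) /\
        {ae lambda, forall x : borel G,
          (fun N : nat => \sum_(0 <= k < N) gs k x) @ \oo --> g x}]].

Definition fourier (f : G -> R[i]) (s : dual) : R[i] :=
  cintegral (fun x => f x * s (- x)).

(* [summability.sum] is the unordered sum, i.e. the limit of the finite partial
   sums along inclusion. *)
Definition bilinear_op (m : dual -> dual -> R[i]) (f g : G -> R[i]) (x : G) :
    R[i] :=
  summability.sum (fun s : dual => summability.sum (fun t : dual =>
    fourier f s * fourier g t * m s t * (s + t) x)).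

Definition multiplier_bound (theta p1 p2 p3 : R) (m : dual -> dual -> R[i])
    (C : R) : Prop :=
  forall f g : G -> R[i], bruhat_smooth f -> bruhat_smooth g ->
    (small_norm p3 theta (bilinear_op m f g) <=
     C%:E * small_norm p1 theta f * small_norm p2 theta g)%E.

(* The dual of a compact group is discrete, so every [m] is measurable. *)
Definition BM (theta p1 p2 p3 : R) (m : dual -> dual -> R[i]) : Prop :=
  (exists M : R, forall s t, complex.Re `|m s t| <= M) /\
  exists2 C : R, 0 < C & multiplier_bound theta p1 p2 p3 m C.

Definition BM_norm (theta p1 p2 p3 : R) (m : dual -> dual -> R[i]) : R :=
  inf [set C : R | 0 < C /\ multiplier_bound theta p1 p2 p3 m C].

Definition translate (s0 t0 : dual) (m : dual -> dual -> R[i]) :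
    dual -> dual -> R[i] :=
  fun s t => m (s - s0) (t - t0).

Definition modulate1 (s0 : G) (m : dual -> dual -> R[i]) :
    dual -> dual -> R[i] :=
  fun s t => s s0 * m s t.

Definition modulate2 (t0 : G) (m : dual -> dual -> R[i]) :
    dual -> dual -> R[i] :=
  fun s t => t t0 * m s t.

End multipliers.

(* Main.v *)
Require Import Defs.
From HB Require Import structures.
From mathcomp Require Import finmap.
From mathcomp Require Import all_boot all_order all_algebra.
From mathcomp Require Import ring_quotient complex.
From mathcomp Require Import all_classical all_reals all_analysis.
From mathcomp Require Import measurable_realfun ring lra.
From mathcomp Require summability.
Set Implicit Arguments.
Unset Strict Implicit.
Unset Printing Implicit Defensive.
Import Order.TTheory GRing.Theory Num.Theory.
Import numFieldNormedType.Exports.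
Local Open Scope classical_set_scope.
Local Open Scope ring_scope.

(* If [m] is translated, [B_m] is conjugated by multiplications by characters;
   if [m] is modulated, it is conjugated by translations of [G]. Both kinds of
   operators preserve the small Lebesgue norms, and the point is that they also
   preserve the Bruhat smooth functions. For a translation this is the chain
   rule. For a character [s] and a function factoring through a Lie quotient
   [G / H], one passes to the kernel [K] of [s] on [H]. As [s] maps [H] onto a
   closed subgroup of the circle, [G / K] is either a finite covering of [G / H]
   or isomorphic to [G / H] times the circle, hence a Lie group; and [s] is
   smooth on [G / K] because the convolution of [s] with a bump function is a
   multiple of [s]. *)

(** The Bruhat smooth functions are the only test functions, so both families of operators must map
    them into themselves; as the operators are invertible, the two multipliers then admit the same
    constants, and no estimate is ever computed. The obstacle is that a character [s] need not be
    constant on the cosets of [H], so that [s * f] needs a smaller subgroup, and G / K has to be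
    given an explicit atlas. With the kernel of [s] on [H], the pair formed by the projection to G /
    H and [s] is injective on G / K, and this pair provides the coordinates. On the circle the
    coordinate is rational, which reduces smoothness to field operations. Smooth means of class C^k
    for every k, and the convolution treats each k separately, so that a truncated power is a
    sufficient bump function and none of class C^oo is built. The convolution is a mean over G and
    is differentiated under the integral by compactness of G, which comes from the finite mass and
    inner regularity. The unordered sums in [bilinear_op] are handled without proving summability:
    the reindexings and rescalings used hold for divergent sums as well. *)

(** * Mean value estimate and differentiability from continuous partial derivatives *)

Section differential_calculus.
Variable R : realType.

Lemma is_derive_line n (f : 'rV[R]_n -> R) (w v : 'rV[R]_n) (s : R) :
  derivable f (w + s *: v) v ->
  is_derive s 1 (fun s : R => f (w + s *: v)) ('D_v f (w + s *: v)).
Proof.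
move=> fv.
have E : (fun h : R => h^-1 *: (((fun s : R => f (w + s *: v)) \o shift s) (h *: 1)
            - f (w + s *: v))) =
         (fun h : R => h^-1 *: ((f \o shift (w + s *: v)) (h *: v)
            - f (w + s *: v))).
  apply/funext => h /=; congr (_ *: (f _ - _)).
  by rewrite -[h *: 1]/(h * 1) mulr1 scalerDl addrCA.
by split; rewrite /derivable /derive E.
Qed.

(** The mean value theorem on the segment gives an increment [tau * 'D_v f] at an intermediate
    point, and that derivative is within [e] of [a]. The hypothesis is symmetric in [s] so that both
    signs of [tau] are covered. *)
Lemma mvt_direction n (f : 'rV[R]_n -> R) (w v : 'rV[R]_n) (a e tau : R) :
  (forall s : R, `|s| <= `|tau| ->
    derivable f (w + s *: v) v /\ `|'D_v f (w + s *: v) - a| <= e) ->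
  `|f (w + tau *: v) - f w - tau * a| <= e * `|tau|.
Proof.
move=> H.
have F0 : f w = f (w + 0 *: v) by rewrite scale0r addr0.
have D (s : R) : `|s| <= `|tau| ->
    is_derive s 1 (fun s : R => f (w + s *: v)) ('D_v f (w + s *: v)).
  by move=> /H [? _]; exact: is_derive_line.
have C (s : R) : `|s| <= `|tau| -> {for s, continuous (fun s : R => f (w + s *: v))}.
  move=> /D [+ _]; move=> /derivable1_diffP; exact: differentiable_continuous.
have [t0|t0] := leP 0 tau.
  have [||c] := @MVT_segment _ (fun s : R => f (w + s *: v))
      (fun s : R => 'D_v f (w + s *: v)) 0 tau t0.
  - move=> x; rewrite in_itv /= => /andP[x0 xt]; apply: D.
    by rewrite !ger0_norm // ltW.
  - apply: continuous_in_subspaceT => x; rewrite inE /= in_itv /= => /andP[x0 xt].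
    by apply: C; rewrite !ger0_norm.
  rewrite in_itv /= subr0 => /andP[c0 ct]; rewrite -F0 => ->.
  rewrite [tau * a]mulrC -mulrBl normrM ler_wpM2r //.
  by have [] := H c _; first by rewrite !ger0_norm.
have [||c] := @MVT_segment _ (fun s : R => f (w + s *: v))
    (fun s : R => 'D_v f (w + s *: v)) tau 0 (ltW t0).
- move=> x; rewrite in_itv /= => /andP[x0 xt]; apply: D.
  by rewrite !ltr0_norm // lerN2 ltW.
- apply: continuous_in_subspaceT => x; rewrite inE /= in_itv /= => /andP[x0 xt].
  by apply: C; rewrite !ler0_norm ?lerN2 // ltW.
rewrite in_itv /= sub0r => /andP[c0 ct]; rewrite -F0 => E.
rewrite -[X in X - _]opprB E mulrN opprK [tau * a]mulrC -mulrBl normrM ler_wpM2r //.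
by have [] := H c _; first by rewrite !ler0_norm ?lerN2 // ltW.
Qed.

Lemma norm_coord_le n (x : 'rV[R]_n) j : `|x 0 j| <= `|x|.
Proof.
rewrite [leRHS]/Num.Def.normr /= mx_normrE.
exact: (le_bigmax _ (fun ij => `|x ij.1 ij.2|) (0, j)).
Qed.

Lemma norm_rV_le n (x : 'rV[R]_n) (e : R) :
  0 <= e -> (forall j, `|x 0 j| <= e) -> `|x| <= e.
Proof.
move=> e0 H; rewrite [leLHS]/Num.Def.normr /= mx_normrE (bigmax_le _ e0) //= => -[i j] _.
by rewrite ord1.
Qed.

(** [Ck] speaks of partial derivatives only, whereas the chain rule needs the differential. One
    moves from [y] to [h + y] by changing one coordinate at a time, and applies [mvt_direction] to
    each move. *)
Lemma differentiable_C1 n (f : 'rV[R]_n -> R) (y : 'rV[R]_n) :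
  (forall j, \forall x \near y, derivable f x (delta_mx 0 j)) ->
  (forall j, {for y, continuous (fun x => 'D_(delta_mx 0 j) f x)}) ->
  differentiable f y /\
  forall h, 'd f y h = \sum_j h 0 j * 'D_(delta_mx 0 j) f y.
Proof.
move=> fd fc.
pose L (h : 'rV[R]_n) : R := \sum_j h 0 j * 'D_(delta_mx 0 j) f y.
have Llin : linear L.
  move=> k u v; rewrite /L scaler_sumr -big_split /=; apply: eq_bigr => j _.
  by rewrite !mxE mulrDl -[k *: _]/(k * _) mulrA.
pose LM := GRing.isLinear.Build _ _ _ _ _ Llin.
pose LL : {linear 'rV[R]_n -> R} := HB.pack L LM.
have Lc : continuous LL.
  move=> x; rewrite /continuous_at -[LL : _ -> _]/L /L.
  apply: (@cvg_big _ _ _ _ predT (@add_continuous R) _ (nbhs x) _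
    (fun j (h : 'rV[R]_n) => h 0 j * 'D_(delta_mx 0 j) f y)
    (fun j => x 0 j * 'D_(delta_mx 0 j) f y) _) => j _.
  by apply: cvgMr_tmp; exact: coord_continuous.
suff E : (f : 'rV[R]_n -> R^o) \o shift y = cst (f y : R^o) + (LL : 'rV[R]_n -> R^o) +o_ (0 : 'rV[R]_n) id.
  have dL := diff_unique Lc E.
  split; last by move=> h; rewrite dL.
  by apply/diff_locallyP; rewrite dL; split.
apply/(@eqaddoP _ _ R^o) => e e0.
(* Each of the [n] coordinates contributes at most [e' * |h|]; dividing by [n + 1] also covers
   [n = 0]. *)
pose e' := e / n.+1%:R.
have e'0 : 0 < e' by rewrite divr_gt0.
have [d /= d0 Hd] : exists2 d : R, 0 < d & forall x, `|x - y| < d -> forall j,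
    derivable f x (delta_mx 0 j) /\
    `|'D_(delta_mx 0 j) f x - 'D_(delta_mx 0 j) f y| <= e'.
  have : \forall x \near y, forall j, derivable f x (delta_mx 0 j) /\
    `|'D_(delta_mx 0 j) f x - 'D_(delta_mx 0 j) f y| <= e'.
    near=> x => j; split; move: j; near: x; apply: filter_forall => j.
      exact: fd.
    by have /cvgrPdistC_le := fc j; exact.
  move=> /nbhs_ballP[d /= d0 Hd]; exists d => // x xd; apply: Hd.
  by rewrite -ball_normE /= distrC.
near=> h.
have hd : `|h| < d.
  near: h; apply/nbhs_ballP; exists d => //= h; rewrite -ball_normE /=.
  by rewrite sub0r normrN.
rewrite /= -[X in X <= _]/(`|f (h + y) - (f y + L h)|).
(* The corners of the path: [w k] has received the first [k] coordinates of [h], so that it runs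
   from [y] to [h + y]. *)
pose w (k : nat) : 'rV[R]_n := y + \row_i (if (i < k)%N then h 0 i else 0).
have step (j : 'I_n) : w j.+1 = w j + h 0 j *: delta_mx 0 j.
  apply/rowP => i; rewrite !mxE eqxx ltnS /=.
  case: (ltngtP i j) => [ij|ij|/val_inj ->].
  - by rewrite -val_eqE /= (ltn_eqF ij) mulr0n mulr0 ?addr0.
  - by rewrite -val_eqE /= (gtn_eqF ij) mulr0n mulr0 !addr0.
  - by rewrite eqxx mulr1n mulr1 addr0.
have w0 : w 0%N = y by apply/rowP => i; rewrite !mxE /= addr0.
have wn : w n = h + y by apply/rowP => i; rewrite !mxE ltn_ord addrC.
have -> : f (h + y) - (f y + L h) =
    \sum_(j < n) (f (w j.+1) - f (w j) - h 0 j * 'D_(delta_mx 0 j) f y).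
  by rewrite sumrB -(big_mkord predT (fun j => f (w j.+1) - f (w j))) telescope_sumr //
    w0 wn opprD addrA.
apply: (le_trans (ler_norm_sum _ _ _)).
apply: (@le_trans _ _ (\sum_(j < n) e' * `|h|)); last first.
  rewrite sumr_const card_ord -mulr_natr mulrAC /e' ler_wpM2r //.
  by rewrite mulrAC ler_pdivrMr // ler_wpM2l ?ler_nat // ltW.
apply: ler_sum => j _; rewrite step.
apply: (@le_trans _ _ (e' * `|h 0 j|)); last by rewrite ler_wpM2l ?norm_coord_le // ltW.
apply: mvt_direction => s sh.
apply: Hd; apply: le_lt_trans hd.
rewrite /w addrAC [y + _]addrC addrK.
apply: norm_rV_le => // i; rewrite !mxE eqxx /=.
case: ifPn => ij.
  by rewrite -val_eqE /= (ltn_eqF ij) mulr0n mulr0 addr0 norm_coord_le.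
rewrite add0r; have [_|_] := eqVneq i j; last by rewrite mulr0n mulr0 normr0.
by rewrite mulr1n mulr1 (le_trans sh) // norm_coord_le.
Unshelve. all: by end_near. Qed.

End differential_calculus.

(** * Calculus of functions of class C^k on open subsets of R^n *)

Section Ck_theory.
Variable R : realType.
Implicit Types n p k : nat.

Lemma continuous_rV (T : topologicalType) n (g : T -> 'rV[R]_n) (x : T) :
  (forall j, {for x, continuous (fun y => g y 0 j)}) -> {for x, continuous g}.
Proof.
move=> gc; apply/cvgrPdist_le => /= e e0; near=> y.
apply: norm_rV_le; first exact: ltW.
move=> j; rewrite !mxE; move: j; near: y; apply: filter_forall => j.
by have /cvgrPdist_le := gc j; exact.
Unshelve. all: by end_near. Qed.

Lemma Ck_continuous n k (U : set 'rV[R]_n) f x :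
  Ck k U f -> U x -> {for x, continuous f}.
Proof. by case: k => [|k] [+ _]; exact. Qed.

Lemma CkS n k (U : set 'rV[R]_n) f : Ck k.+1 U f -> Ck k U f.
Proof.
elim: k f => [|k IH] f [fc fd]; first by split.
split => // i; have [d D] := fd i; split => //; exact: IH.
Qed.

Lemma continuous_near_eq (T S : topologicalType) (V : set T) (f g : T -> S) x :
  open V -> V x -> (forall y, V y -> f y = g y) ->
  {for x, continuous g} -> {for x, continuous f}.
Proof.
move=> Vo Vx fg gc A; rewrite /= (fg x Vx) => /gc; rewrite /= !nbhs_simpl => gA.
apply: filterS2 (open_nbhs_nbhs (conj Vo Vx)) gA => y Vy.
by rewrite /= fg.
Qed.

(** Derivatives depend only on germs. Expressions read in charts are meaningful only on the image of
    the chart, so nearly every proof below replaces a function by one that agrees with it on an open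
    set. *)
Lemma Ck_local n k (U : set 'rV[R]_n) f :
  (forall x, U x -> exists V g,
     [/\ open V, V x, forall y, V y -> f y = g y & Ck k V g]) -> Ck k U f.
Proof.
move=> H; have C x : U x -> {for x, continuous f}.
  move=> /H[V [g [Vo Vx fg gk]]].
  exact: continuous_near_eq Vo Vx fg (Ck_continuous gk Vx).
elim: k U f H C => [|k IH] U f H C; split => //.
move=> i; split=> [x /H[V [g [Vo Vx fg [_ gk]]]]|].
    apply: (@near_eq_derivable _ _ _ g); last exact: (gk i).1.
    by near=> y; apply/esym/fg; near: y; exact: open_nbhs_nbhs.
have E x : U x -> exists V h, [/\ open V, V x,
    forall y, V y -> 'D_(delta_mx 0 i) f y = h y & Ck k V h].
  move=> /H[V [g [Vo Vx fg [_ gk]]]].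
  exists V, (fun x => 'D_(delta_mx 0 i) g x); split => //; last exact: (gk i).2.
  move=> y Vy; apply: near_eq_derive.
  by near=> z; apply/fg; near: z; exact: open_nbhs_nbhs.
apply: IH => // x /E[V [h [Vo Vx fh hk]]].
exact: continuous_near_eq Vo Vx fh (Ck_continuous hk Vx).
Unshelve. all: by end_near. Qed.

Lemma Ck_eq n k (U : set 'rV[R]_n) f g :
  open U -> (forall x, U x -> f x = g x) -> Ck k U g -> Ck k U f.
Proof. by move=> Uo fg gk; apply: Ck_local => x Ux; exists U, g; split. Qed.

Lemma Ck_subset n k (U V : set 'rV[R]_n) f :
  open V -> U `<=` V -> Ck k V f -> Ck k U f.
Proof.
by move=> Vo UV fk; apply: Ck_local => x /UV Vx; exists V, f; split.
Qed.

Lemma Ck_cst n k (U : set 'rV[R]_n) (c : R) : Ck k U (fun=> c).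
Proof.
have C d x : U x -> {for x, continuous (fun=> d : R)} by move=> _; exact: cst_continuous.
elim: k c => [|k IH] c; split => //; try exact: C.
move=> i; split => [x _|]; first exact: derivable_cst.
have -> : 'D_(delta_mx 0 i) (fun=> c) = (fun=> 0) :> ('rV[R]_n -> R).
  by apply/funext => x; exact: derive_cst.
exact: IH.
Qed.

Lemma derive_coord n (i j : 'I_n) (x : 'rV[R]_n) :
  derivable (fun y : 'rV[R]_n => y 0 j) x (delta_mx 0 i) /\
  'D_(delta_mx 0 i) (fun y : 'rV[R]_n => y 0 j) x = (i == j)%:R.
Proof.
have idd := @derivable_id _ 'rV[R]_n x (delta_mx 0 i).
split; first by have /derivable_mxP := idd; exact.
have := @derive_id _ 'rV[R]_n x (delta_mx 0 i); rewrite derive_mx //.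
by move=> /matrixP /(_ 0 j); rewrite !mxE eqxx /= eq_sym.
Qed.

Lemma Ck_coord n k (U : set 'rV[R]_n) j : Ck k U (fun x => x 0 j).
Proof.
have C x : U x -> {for x, continuous (fun x : 'rV[R]_n => x 0 j : R)}.
  by move=> _; exact: coord_continuous.
case: k => [|k]; split => //.
move=> i; split => [x _|]; first exact: (derive_coord i j x).1.
have -> : 'D_(delta_mx 0 i) (fun x : 'rV[R]_n => x 0 j : R) =
    (fun=> (i == j)%:R) :> ('rV[R]_n -> R).
  by apply/funext => x; exact: (derive_coord i j x).2.
exact: Ck_cst.
Qed.

Lemma Ck_add n k (U : set 'rV[R]_n) f g : open U ->
  Ck k U f -> Ck k U g -> Ck k U (fun x => f x + g x).
Proof.
move=> Uo fk gk.
have C x : U x -> {for x, continuous (fun x => f x + g x)}.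
  move=> Ux; exact: (continuousD (Ck_continuous fk Ux) (Ck_continuous gk Ux)).
elim: k f g fk gk C => [|k IH] f g [fc fd] [gc gd] C; split => //.
move=> i; split => [x Ux|].
  by apply: derivableD; [exact: (fd i).1|exact: (gd i).1].
apply: (Ck_eq Uo _ (IH _ _ (fd i).2 (gd i).2 _)) => x Ux.
  by rewrite deriveD //; [exact: (fd i).1|exact: (gd i).1].
exact: (continuousD (Ck_continuous (fd i).2 Ux) (Ck_continuous (gd i).2 Ux)).
Qed.

Lemma Ck_sum n k (U : set 'rV[R]_n) p (f : 'I_p -> 'rV[R]_n -> R) : open U ->
  (forall j, Ck k U (f j)) -> Ck k U (fun x => \sum_j f j x).
Proof.
move=> Uo fk; elim: p f fk => [|p IH] f fk.
  apply: (Ck_eq Uo (g := fun=> 0)); last exact: Ck_cst.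
  by move=> x _; rewrite big_ord0.
apply: (Ck_eq Uo (g := fun x => \sum_(j < p) f (widen_ord (leqnSn p) j) x + f ord_max x)).
  by move=> x _; rewrite big_ord_recr.
by apply: Ck_add => //; exact: IH.
Qed.

Lemma Ck_mul n k (U : set 'rV[R]_n) f g : open U ->
  Ck k U f -> Ck k U g -> Ck k U (fun x => f x * g x).
Proof.
move=> Uo; elim: k f g => [|k IH] f g fk gk; have C x : U x ->
  {for x, continuous (fun x => f x * g x)} by
    move=> Ux; exact: (continuousM (Ck_continuous fk Ux) (Ck_continuous gk Ux)).
  by split.
split => //; have [_ fd] := fk; have [_ gd] := gk.
move=> i; split => [x Ux|].
  by apply: derivableM; [exact: (fd i).1|exact: (gd i).1].
apply: (Ck_eq Uo _ (Ck_add Uo (IH _ _ (CkS fk) (gd i).2) (IH _ _ (CkS gk) (fd i).2))).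
by move=> x Ux; rewrite deriveM //; [exact: (fd i).1|exact: (gd i).1].
Qed.

Lemma Ck_opp n k (U : set 'rV[R]_n) f : open U ->
  Ck k U f -> Ck k U (fun x => - f x).
Proof.
move=> Uo fk; apply: (Ck_eq Uo (g := fun x => -1 * f x)).
  by move=> x _; rewrite mulN1r.
by apply: Ck_mul => //; exact: Ck_cst.
Qed.

Lemma Ck_sub n k (U : set 'rV[R]_n) f g : open U ->
  Ck k U f -> Ck k U g -> Ck k U (fun x => f x - g x).
Proof. by move=> Uo fk gk; apply: Ck_add => //; exact: Ck_opp. Qed.

Lemma Ck_inv n k (U : set 'rV[R]_n) f : open U -> (forall x, U x -> f x != 0) ->
  Ck k U f -> Ck k U (fun x => (f x)^-1).
Proof.
move=> Uo f0; elim: k => [|k IH] fk; have C x : U x ->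
  {for x, continuous (fun x => (f x)^-1)} by
    move=> Ux; exact: (continuousV (f0 x Ux) (Ck_continuous fk Ux)).
  by split.
split => //; have [_ fd] := fk; have fI := IH (CkS fk).
move=> i; split => [x Ux|].
  by apply: derivableV; [exact: f0|exact: (fd i).1].
apply: (Ck_eq Uo _ (Ck_opp Uo (Ck_mul Uo (Ck_mul Uo fI fI) (fd i).2))).
move=> x Ux; rewrite deriveV; [|exact: f0|exact: (fd i).1].
by rewrite -[LHS]/(_ * _) mulNr -exprVn expr2.
Qed.

(** Restricting to the line [h *: v + x] leaves a function of one real variable, for which
    derivability is differentiability; hence only the derivative of [g] along [v] is required. *)
Lemma derive_comp_differentiable n (W : normedModType R)
  (f : W -> R) (g : 'rV[R]_n -> W) x v :
  differentiable f (g x) -> derivable g x v ->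
  derivable (fun y => f (g y)) x v /\
  'D_v (fun y => f (g y)) x = 'd f (g x) ('D_v g x).
Proof.
move=> fd gd.
pose c (h : R) := g (h *: v + x).
have c0 : c 0 = g x by rewrite /c scale0r add0r.
have cd : differentiable c 0 by apply/derivable1_diffP; move: gd => /derivable1P.
have fd' : differentiable f (c 0) by rewrite c0.
have fcd : differentiable (f \o c) 0 by exact: differentiable_comp.
have fgd : derivable (fun y => f (g y)) x v.
  by apply/derivable1P/derivable1_diffP.
have E (W' : normedModType R) (h : 'rV[R]_n -> W') :
    'D_v h x = 'D_1 (fun t : R => h (t *: v + x)) 0.
  rewrite /derive.
  suff -> : (fun t : R => t^-1 *: (((fun s : R => h (s *: v + x)) \o shift 0) (t *: 1)
      - h (0 *: v + x))) = (fun t : R => t^-1 *: ((h \o shift x) (t *: v) - h x)) by [].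
  by apply/funext => t /=; rewrite scale0r add0r addr0 -[t *: 1]/(t * 1) mulr1.
split => //; rewrite !E.
rewrite -[LHS]/('D_1 (f \o c) 0) (deriveE _ fcd) (deriveE _ cd).
by rewrite (diff_comp cd fd') /= c0.
Qed.

(** The partial derivatives of the composite are sums of products of those of [g] with those of [f]
    taken at [g x]; the induction hypothesis applies to the latter. *)
Lemma Ck_comp n p k (U : set 'rV[R]_n) (V : set 'rV[R]_p) f g :
  open U -> open V -> (forall x, U x -> V (g x)) ->
  (forall j, Ck k U (fun x => g x 0 j)) -> Ck k V f ->
  Ck k U (fun x => f (g x)).
Proof.
move=> Uo Vo UV; elim: k f => [|k IH] f gk fk; have C x : U x ->
  {for x, continuous (fun x => f (g x))} by
    move=> Ux; apply: (@continuous_comp _ _ _ g f);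
      [apply: continuous_rV => j; exact: Ck_continuous (gk j) Ux
      |exact: Ck_continuous fk (UV _ Ux)].
  by split.
split => //; have [_ fd] := fk.
have D i x : U x -> derivable (fun y => f (g y)) x (delta_mx 0 i) /\
    'D_(delta_mx 0 i) (fun y => f (g y)) x =
    \sum_j 'D_(delta_mx 0 i) (fun y => g y 0 j) x * 'D_(delta_mx 0 j) f (g x).
  move=> Ux.
  have [|j|df dfE] := @differentiable_C1 _ _ f (g x).
  - move=> j; near=> y; apply: (fd j).1; near: y.
    by apply: open_nbhs_nbhs; split => //; exact: UV.
  - exact: Ck_continuous (fd j).2 (UV _ Ux).
  have gd : derivable g x (delta_mx 0 i).
    by apply/derivable_mxP => a j; rewrite ord1; exact: ((gk j).2 i).1.
  have [d ->] := derive_comp_differentiable df gd.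
  split => //; rewrite dfE; apply: eq_bigr => j _; congr (_ * _).
  by rewrite derive_mx // mxE.
move=> i; split => [x Ux|]; first exact: (D i x Ux).1.
apply: (Ck_eq Uo (fun x Ux => (D i x Ux).2)).
apply: Ck_sum => // j; apply: Ck_mul => //; first exact: ((gk j).2 i).2.
by apply: (IH (fun y => 'D_(delta_mx 0 j) f y)) => [j'|]; [exact: CkS|exact: (fd j).2].
Unshelve. all: by end_near. Qed.

(** Only [t = 0] needs care: the exponent is at least 2, so the difference quotient is at most [|h|]
    in absolute value once [|h| <= 1]. *)
Lemma is_derive_pos_part_exp k (t : R) :
  is_derive t 1 (fun t : R => Num.max 0 t ^+ k.+2) (k.+2%:R * Num.max 0 t ^+ k.+1).
Proof.
have [t0|t0|->] := ltgtP t 0.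
- rewrite expr0n /= mulr0.
  have H0 := @is_derive_cst R R^o R^o 0 t 1.
  apply: near_eq_is_derive H0; near=> s; rewrite max_l ?expr0n // ltW //; near: s; exact: lt_nbhsl.
- have H0 : is_derive t 1 (fun s : R => s ^+ k.+2) (k.+2%:R * t ^+ k.+1).
    by split; [exact: exprn_derivable
      |rewrite exp_derive; exact: mulr1].
  apply: near_eq_is_derive H0.
  by near=> s; rewrite max_r // ltW //; near: s; exact: lt_nbhsr.
- rewrite expr0n /= mulr0.
  have H : (fun h : R => h^-1 *: (((fun t : R => Num.max 0 t ^+ k.+2) \o shift 0) (h *: 1) - Num.max 0 0 ^+ k.+2))
     @ 0^' --> (0 : R).
    apply/cvgrPdist_le => e e0; near=> h.
    rewrite /= maxxx expr0n /= subr0 addr0 sub0r normrN -[h *: 1]/(h * 1) mulr1.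
    rewrite -[_ *: _]/(_ * _) normrM normfV normrX.
    have h0 : h != 0 by near: h; exact: nbhs_dnbhs_neq.
    rewrite ler_pdivrMl ?normr_gt0 //.
    have mh : `|Num.max 0 h| <= `|h|.
      by have [|] := leP 0 h => //; rewrite normr0.
    have h1 : `|h| <= 1 by near: h; exact: dnbhs0_le.
    have he : `|h| <= e by near: h; exact: dnbhs0_le.
    apply: (@le_trans _ _ (`|h| ^+ k.+2)); first by rewrite lerXn2r ?nnegrE.
    rewrite exprS ler_wpM2l // (le_trans _ he) // exprS ler_piMr //.
    by rewrite exprn_ile1.
  by split; [apply/cvg_ex; exists 0|exact: cvg_lim].
Unshelve. all: by end_near. Qed.

(** Each differentiation lowers the exponent by one, and the exponent 1 is still continuous: this
    fixes [k + 1]. The bump functions are built from these truncated powers. *)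
Lemma Ck_pos_part_exp n k (U : set 'rV[R]_n) f : open U -> Ck k U f ->
  Ck k U (fun x => Num.max 0 (f x) ^+ k.+1).
Proof.
move=> Uo; elim: k => [|k IH] fk; have C x : U x ->
  {for x, continuous (fun x => Num.max 0 (f x))} by
    move=> Ux; apply: (@continuous_max _ _ (fun=> 0) f);
      [exact: cst_continuous|exact: Ck_continuous fk Ux].
  by split.
have D i x : U x -> derivable (fun x => Num.max 0 (f x) ^+ k.+2) x (delta_mx 0 i) /\
    'D_(delta_mx 0 i) (fun x => Num.max 0 (f x) ^+ k.+2) x =
    k.+2%:R * Num.max 0 (f x) ^+ k.+1 * 'D_(delta_mx 0 i) f x.
  move=> Ux; have fd := (fk.2 i).1 x Ux.
  have [pd pE] := is_derive_pos_part_exp k (f x).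
  have pdf := (derivable1_diffP _ _).1 pd.
  have [d ->] := derive_comp_differentiable (W := R^o) pdf fd.
  split => //.
  by rewrite (diff1E pdf) derive1E pE -[LHS]/(_ * _) mulrC.
split => [x Ux|i].
  apply: (@continuous_comp _ _ _ (fun x => Num.max 0 (f x)) (fun t => t ^+ k.+2)).
    exact: C.
  exact: exprn_continuous.
split => [x Ux|]; first exact: (D i x Ux).1.
apply: (Ck_eq Uo (fun x Ux => (D i x Ux).2)).
apply: Ck_mul => //; last exact: (fk.2 i).2.
by apply: Ck_mul => //; [exact: Ck_cst|exact/IH/CkS].
Qed.

End Ck_theory.

(** * Means over a compact group and their dependence on parameters *)

Lemma continuous_pair_cst (S T : topologicalType) (x : S) :
  continuous (fun y : T => (x, y)).
Proof.
move=> y A [[B C] [/= Bx Cy] BC]; rewrite /= nbhs_simpl /=.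
apply: filterS Cy => z Cz; apply: BC; split => //=; exact: nbhs_singleton.
Qed.

Section integral_compact_group.
Variables (R : realType) (G : topologicalZmodType).
Variable lambda : {measure set (borel G) -> \bar R}.
Hypothesis compactG : compact [set: G].
Hypothesis lambda1 : lambda [set: G] = 1%E.

Lemma measurable_continuous (h : G -> R) :
  continuous h -> measurable_fun [set: borel G] (h : borel G -> R).
Proof.
move=> /continuousP hc; apply: (measurability _ (measurable_realfun.RGenOpens.measurableE R)).
move=> _ [_ [a [b ->] <-]]; rewrite setTI.
by apply: sub_sigma_algebra; apply: hc; exact: interval_open.
Qed.

Lemma continuous_bounded (h : G -> R) :
  continuous h -> exists2 M, 0 < M & forall x, `|h x| <= M.
Proof.
move=> hc; have : compact [set h x | x in [set: G]].
  by apply: continuous_compact => //; exact: continuous_subspaceT.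
move=> /compact_bounded[M [_ HM]].
(* The 1 makes the bound positive, so that one may divide by it. *)
exists (Num.max 1 (M + 1)); first by rewrite lt_max ltr01.
move=> x; apply: HM; last by exists x.
by rewrite lt_max ltrDl ltr01 orbT.
Qed.

Lemma integrable_continuous (h : G -> R) :
  continuous h -> lambda.-integrable [set: borel G] (EFin \o (h : borel G -> R)).
Proof.
move=> hc; apply: measurable_bounded_integrable => //.
- by rewrite lambda1 ltry.
- exact: measurable_continuous.
- have [M _ HM] := continuous_bounded hc.
  by exists M; split; [exact: num_real|move=> N MN x _; exact: le_trans (HM x) (ltW MN)].
Qed.

Lemma continuous_subr (f g : G -> R) : continuous f -> continuous g ->
  continuous (fun x => f x - g x).
Proof. by move=> fc gc x; apply: cvgB; [exact: fc|exact: gc]. Qed.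

Lemma continuous_scaler (c : R) (f : G -> R) : continuous f ->
  continuous (fun x => c * f x).
Proof. by move=> fc x; apply: cvgM; [exact: cvg_cst|exact: fc]. Qed.

Definition mean (h : G -> R) : R := Rintegral lambda setT (h : borel G -> R).

Lemma meanB (f g : G -> R) : continuous f -> continuous g ->
  mean (fun x => f x - g x) = mean f - mean g.
Proof. by move=> fc gc; apply: RintegralB => //; exact: integrable_continuous. Qed.

Lemma meanD (f g : G -> R) : continuous f -> continuous g ->
  mean (fun x => f x + g x) = mean f + mean g.
Proof. by move=> fc gc; apply: RintegralD => //; exact: integrable_continuous. Qed.

Lemma meanZ (c : R) (f : G -> R) : continuous f ->
  mean (fun x => c * f x) = c * mean f.
Proof. by move=> fc; apply: RintegralZl => //; exact: integrable_continuous. Qed.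

Lemma mean_cst (c : R) : mean (fun=> c) = c.
Proof. by rewrite /mean Rintegral_cst // lambda1 mulr1. Qed.

Lemma le_mean (f g : G -> R) : continuous f -> continuous g ->
  (forall x, f x <= g x) -> mean f <= mean g.
Proof.
by move=> fc gc fg; apply: le_Rintegral => //; exact: integrable_continuous.
Qed.

Lemma norm_mean_le (h : G -> R) (c : R) : continuous h ->
  (forall x, `|h x| <= c) -> `|mean h| <= c.
Proof.
move=> hc H; rewrite ler_norml; apply/andP; split.
  rewrite -(mean_cst (- c)); apply: le_mean => // [|x].
    by move=> ?; exact: cst_continuous.
  by have := H x; rewrite ler_norml => /andP[].
rewrite -[leRHS](mean_cst c); apply: le_mean => // [|x].
  by move=> ?; exact: cst_continuous.
by have := H x; rewrite ler_norml => /andP[].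
Qed.

(** The regularity needed to differentiate under the integral: derivatives are taken in the
    parameter [x] alone, and each must be jointly continuous in [x] and the group variable. *)
Fixpoint Ck_family n k (U : set 'rV[R]_n) (Phi : 'rV[R]_n -> G -> R) : Prop :=
  (forall x y, U x ->
    {for (x, y), continuous (fun z : 'rV[R]_n * G => Phi z.1 z.2)}) /\
  if k is k'.+1 then
    forall i : 'I_n,
      (forall x y, U x -> derivable (Phi^~ y) x (delta_mx 0 i)) /\
      Ck_family k' U (fun x y => 'D_(delta_mx 0 i) (Phi^~ y) x)
  else True.

Lemma Ck_family_continuous n k (U : set 'rV[R]_n) Phi x y :
  Ck_family k U Phi -> U x ->
  {for (x, y), continuous (fun z : 'rV[R]_n * G => Phi z.1 z.2)}.
Proof. by case: k => [|k] [+ _] Ux; exact. Qed.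

Lemma Ck_family_continuousr n k (U : set 'rV[R]_n) Phi x :
  Ck_family k U Phi -> U x -> continuous (Phi x).
Proof.
move=> Pk Ux y; have c := Ck_family_continuous (y := y) Pk Ux.
apply: (@continuous_comp _ _ _ (fun y => (x, y))
  (fun z : 'rV[R]_n * G => Phi z.1 z.2)) => //.
exact: continuous_pair_cst.
Qed.

Lemma derive_row_mx n p (Psi : 'rV[R]_(n + p) -> R) (c : 'rV[R]_p) x i :
  derivable Psi (row_mx x c) (delta_mx 0 (lshift p i)) ->
  derivable (fun x : 'rV[R]_n => Psi (row_mx x c)) x (delta_mx 0 i) /\
  'D_(delta_mx 0 i) (fun x : 'rV[R]_n => Psi (row_mx x c)) x =
  'D_(delta_mx 0 (lshift p i)) Psi (row_mx x c).
Proof.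
have E : (fun h : R => h^-1 *: ((Psi \o shift (row_mx x c))
      (h *: delta_mx 0 (lshift p i)) - Psi (row_mx x c))) =
    (fun h : R => h^-1 *: (((fun x : 'rV[R]_n => Psi (row_mx x c)) \o shift x)
      (h *: delta_mx 0 i) - Psi (row_mx x c))).
  apply/funext => h /=; congr (_ *: (Psi _ - _)); apply/rowP => j.
  rewrite !mxE; case: splitP => a ja; rewrite ?mxE /=.
    by congr (_ * _ + _); rewrite -!val_eqE /= ja.
  rewrite -val_eqE /= ja gtn_eqF ?andbF ?mulr0 ?add0r //.
  exact: ltn_addr.
by rewrite /derivable /derive E.
Qed.

(** The group variable enters through a merely continuous [d], while [Psi] is of class C^k in both
    blocks. The derivatives in [x] are then partial derivatives of [Psi] in the first block, and
    keep the same form. *)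
Lemma Ck_family_local n p k (U : set 'rV[R]_n) (Phi : 'rV[R]_n -> G -> R) :
  (forall x y, U x -> exists V Y W (Psi : 'rV[R]_(n + p) -> R) (d : G -> 'rV[R]_p),
    [/\ [/\ open V, V x, open Y & Y y], open W,
        forall y', Y y' -> {for y', continuous d},
        forall x' y', V x' -> Y y' -> W (row_mx x' (d y')) /\
          Phi x' y' = Psi (row_mx x' (d y')) &
        Ck k W Psi]) -> Ck_family k U Phi.
Proof.
have Cont m (Phi0 : 'rV[R]_n -> G -> R) x y : (exists V Y W (Psi : 'rV[R]_(n + p) -> R) (d : G -> 'rV[R]_p),
    [/\ [/\ open V, V x, open Y & Y y], open W,
        forall y', Y y' -> {for y', continuous d},
        forall x' y', V x' -> Y y' -> W (row_mx x' (d y')) /\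
          Phi0 x' y' = Psi (row_mx x' (d y')) &
        Ck m W Psi]) ->
    {for (x, y), continuous (fun z : 'rV[R]_n * G => Phi0 z.1 z.2)}.
  move=> [V [Y [W [Psi [d [[Vo Vx Yo Yy] Wo dc H Pk]]]]]].
  apply: (@continuous_near_eq _ _ (V `*` Y) _
    (fun z : 'rV[R]_n * G => Psi (row_mx z.1 (d z.2)))).
  - rewrite openE => -[x' y'] [/= Vx' Yy']; exists (V, Y) => //=.
    by split; exact: open_nbhs_nbhs.
  - by [].
  - by move=> [x' y'] [/= Vx' Yy']; exact: (H _ _ Vx' Yy').2.
  - apply: (@continuous_comp _ _ _ (fun z : 'rV[R]_n * G => row_mx z.1 (d z.2)) Psi).
      apply: continuous_rV => j.
      case: (splitP j) => a ja.
        have -> : j = lshift p a by apply/val_inj.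
        under [X in {for _, continuous X}]eq_fun do rewrite row_mxEl.
        apply: (@continuous_comp _ _ _ fst (fun v : 'rV[R]_n => v 0 a)).
          exact: cvg_fst.
        exact: coord_continuous.
      have -> : j = rshift n a by apply/val_inj.
      under [X in {for _, continuous X}]eq_fun do rewrite row_mxEr.
      apply: (@continuous_comp _ _ _ (d \o snd) (fun v : 'rV[R]_p => v 0 a)).
        apply: (@continuous_comp _ _ _ snd d); first exact: cvg_snd.
        exact: dc.
      exact: coord_continuous.
    exact: Ck_continuous Pk (H _ _ Vx Yy).1.
elim: k Phi => [|k IH] Phi H; split => //; try by move=> x y /(H x y) /Cont.
move=> i.
have D x y x' y' V Y W (Psi : 'rV[R]_(n + p) -> R) (d : G -> 'rV[R]_p) :
    [/\ [/\ open V, V x, open Y & Y y], open W,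
        forall y', Y y' -> {for y', continuous d},
        forall x' y', V x' -> Y y' -> W (row_mx x' (d y')) /\
          Phi x' y' = Psi (row_mx x' (d y')) &
        Ck k.+1 W Psi] -> V x' -> Y y' ->
    derivable (Phi^~ y') x' (delta_mx 0 i) /\
    'D_(delta_mx 0 i) (Phi^~ y') x' =
    'D_(delta_mx 0 (lshift p i)) Psi (row_mx x' (d y')).
  move=> [[Vo Vx Yo Yy] Wo dc E [_ Pk]] Vx' Yy'.
  have [Pd _] := Pk (lshift p i).
  have [rd rE] := derive_row_mx (Pd _ (E _ _ Vx' Yy').1).
  have e : \forall z \near x', Phi z y' = Psi (row_mx z (d y')).
    apply: filterS (open_nbhs_nbhs (conj Vo Vx')) => z Vz.
    exact: (E _ _ Vz Yy').2.
  split; first by apply: near_eq_derivable rd; apply: filterS e => z ->.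
  by rewrite -rE; exact: near_eq_derive.
split=> [x y Ux|].
  have [V [Y [W [Psi [d A]]]]] := H x y Ux.
  by have [[_ Vx _ Yy] _ _ _ _] := A; exact: (D _ _ _ _ _ _ _ _ _ A Vx Yy).1.
have H' x y : U x -> exists V Y W (Psi : 'rV[R]_(n + p) -> R) (d : G -> 'rV[R]_p),
    [/\ [/\ open V, V x, open Y & Y y], open W,
        forall y', Y y' -> {for y', continuous d},
        forall x' y', V x' -> Y y' -> W (row_mx x' (d y')) /\
          'D_(delta_mx 0 i) (Phi^~ y') x' = Psi (row_mx x' (d y')) &
        Ck k W Psi].
  move=> Ux; have [V [Y [W [Psi [d A]]]]] := H x y Ux.
  exists V, Y, W, (fun w => 'D_(delta_mx 0 (lshift p i)) Psi w), d.
  have [VY Wo dc E [_ Pk]] := A; split => //; last exact: (Pk _).2.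
  move=> x' y' Vx' Yy'; split; first exact: (E _ _ Vx' Yy').1.
  exact: (D _ _ _ _ _ _ _ _ _ A Vx' Yy').2.
exact: IH.
Qed.

(** A tube argument: near each [y] joint continuity controls both [Phi x' y'] and [Phi x y'] within
    [e / 2] of [Phi x y], and finitely many such neighbourhoods cover the group. *)
Lemma uniform_on_compact n (Phi : 'rV[R]_n -> G -> R) x e : 0 < e ->
  (forall y, {for (x, y), continuous (fun z : 'rV[R]_n * G => Phi z.1 z.2)}) ->
  \forall x' \near x, forall y, `|Phi x' y - Phi x y| <= e.
Proof.
move=> e0 Pc.
have H : \forall x' \near x, [set: G] `<=` (fun y => `|Phi x' y - Phi x y| <= e).
  apply: ((compact_near_coveringP [set: G]).1 compactG _ (nbhs x)
    (fun x' y => `|Phi x' y - Phi x y| <= e) (nbhs_filter x)) => y _.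
  have e20 : 0 < e / 2 by rewrite divr_gt0.
  have /cvgrPdistC_le /(_ _ e20) [[A B] [/= Ax By] AB] := Pc y.
  exists (B, A) => //= -[y' x'] [/= By' Ax'].
  have H1 : `|Phi x' y' - Phi x y| <= e / 2 by exact: (AB (x', y')).
  have H2 : `|Phi x y' - Phi x y| <= e / 2.
    by apply: (AB (x, y')); split => //=; exact: nbhs_singleton.
  rewrite -(subrKA (Phi x y)) (splitr e) (le_trans (ler_normD _ _)) // lerD //.
  by rewrite distrC.
by apply: filterS H => x' H y; exact: H.
Qed.

Lemma continuous_forP (T : topologicalType) (f : T -> R) x :
  (forall e, 0 < e -> \forall y \near x, `|f y - f x| <= e) ->
  {for x, continuous f}.
Proof. by move=> H; apply/cvgrPdistC_le. Qed.

(** Differentiation under the integral sign. The difference quotient of [Phi] is uniformly close to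
    its derivative by [mvt_direction] and compactness; the weight [w] is only multiplied in, at the
    cost of its bound [M]. *)
Lemma Ck_mean n k (U : set 'rV[R]_n) (Phi : 'rV[R]_n -> G -> R) (w : G -> R) :
  open U -> continuous w -> Ck_family k U Phi ->
  Ck k U (fun x => mean (fun y => Phi x y * w y)).
Proof.
move=> Uo wc; have [M M0 wM] := continuous_bounded wc.
have Pwc m Psi x : Ck_family m U Psi -> U x -> continuous (fun y => Psi x y * w y).
  move=> Pk Ux y; apply: continuousM; last exact: wc.
  exact: (Ck_family_continuousr Pk Ux).
have C m Psi x : Ck_family m U Psi -> U x ->
    {for x, continuous (fun x => mean (fun y => Psi x y * w y))}.
  move=> Pk Ux; apply: continuous_forP => e e0.
  have eM : 0 < e / M by rewrite divr_gt0.
  have := uniform_on_compact eM (fun y => Ck_family_continuous (y := y) Pk Ux).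
  move=> un; near=> x'.
  have Ux' : U x' by near: x'; exact: open_nbhs_nbhs.
  rewrite -meanB; [|exact: Pwc Pk Ux'|exact: Pwc Pk Ux].
  apply: norm_mean_le.
    by apply: continuous_subr; [exact: Pwc Pk Ux'|exact: Pwc Pk Ux].
  move=> y; rewrite -mulrBl normrM -[leRHS](divfK (lt0r_neq0 M0)).
  by apply: ler_pM => //; move: y; near: x'.
elim: k Phi => [|k IH] Phi Pk; split => //; try by move=> x Ux; exact: C Pk Ux.
move=> i; have [_ /(_ i)[Pd PD]] := Pk.
have D x : U x -> is_derive x (delta_mx 0 i) (fun x => mean (fun y => Phi x y * w y))
    (mean (fun y => 'D_(delta_mx 0 i) (Phi^~ y) x * w y)).
  move=> Ux.
  suff H : (fun h : R => h^-1 *: (((fun x => mean (fun y => Phi x y * w y)) \o shift x)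
        (h *: delta_mx 0 i) - mean (fun y => Phi x y * w y))) @ 0^' -->
      mean (fun y => 'D_(delta_mx 0 i) (Phi^~ y) x * w y).
    by split; [apply/cvg_ex; eexists; exact: H|exact: cvg_lim].
  apply/cvgrPdistC_le => e e0.
  have eM : 0 < e / M by rewrite divr_gt0.
  have un := uniform_on_compact eM (fun y => Ck_family_continuous (y := y) PD Ux).
  (* A ball on which the derivative varies by at most [e / M], uniformly in [y]; the whole segment
     from [x] to [x + h *: delta_mx 0 i] stays in it when [|h| < r]. *)
  have /nbhs_ballP[r /= r0 rU] : \forall x' \near x, U x' /\ forall y,
      `|'D_(delta_mx 0 i) (Phi^~ y) x' - 'D_(delta_mx 0 i) (Phi^~ y) x| <= e / M.
    by apply: filterI un; exact: open_nbhs_nbhs.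
  near=> h.
  have h0 : h != 0 by near: h; exact: nbhs_dnbhs_neq.
  have hr : `|h| < r by near: h; exact: dnbhs0_lt.
  have B (s : R) : `|s| <= `|h| -> ball x r (x + s *: delta_mx 0 i).
    move=> sh; rewrite -ball_normE /= opprD addrA subrr add0r normrN.
    apply: le_lt_trans hr; apply: norm_rV_le => // j; rewrite !mxE normrM.
    by rewrite (le_trans _ sh) // ler_piMr //; case: (_ && _); rewrite ?normr1 ?normr0.
  have Uh : U (x + h *: delta_mx 0 i) by exact: (rU _ (B h _)).1.
  rewrite /= [h *: _ + x]addrC -[_ *: _]/(_ * _) -meanB; [|exact: Pwc Pk Uh|exact: Pwc Pk Ux].
  rewrite -meanZ; last first.
    by apply: continuous_subr; [exact: Pwc Pk Uh|exact: Pwc Pk Ux].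
  have sc : continuous (fun y => h^-1 *
      (Phi (x + h *: delta_mx 0 i) y * w y - Phi x y * w y)).
    apply: continuous_scaler.
    by apply: continuous_subr; [exact: Pwc Pk Uh|exact: Pwc Pk Ux].
  rewrite -meanB; [|exact: sc|exact: Pwc PD Ux].
  apply: norm_mean_le; first by apply: continuous_subr => //; exact: Pwc PD Ux.
  move=> y; rewrite -mulrBl mulrA -mulrBl normrM -[leRHS](divfK (lt0r_neq0 M0)).
  apply: ler_pM => //.
  have -> : h^-1 * (Phi (x + h *: delta_mx 0 i) y - Phi x y) - 'D_(delta_mx 0 i) (Phi^~ y) x
     = h^-1 * (Phi (x + h *: delta_mx 0 i) y - Phi x y - h * 'D_(delta_mx 0 i) (Phi^~ y) x).
    by rewrite [RHS]mulrBr (mulKf h0).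
  rewrite normrM normfV ler_pdivrMl ?normr_gt0 // [leRHS]mulrC.
  apply: (mvt_direction (f := Phi^~ y)) => s sh.
  have [Us Ds] := rU _ (B s sh).
  by split; [exact: Pd|exact: Ds].
split => [x Ux|]; first by have [] := D x Ux.
apply: (Ck_eq Uo _ (IH _ PD)) => x Ux.
by have [_ ->] := D x Ux.
Unshelve. all: by end_near. Qed.

End integral_compact_group.

(** * Embeddings of compact spaces and continuity into products *)

Section topology_preliminaries.

Lemma open_in_preimage (S T : topologicalType) (U : set S) (O : set T) (f : S -> T) :
  open U -> open O -> (forall x, U x -> {for x, continuous f}) ->
  open [set x | U x /\ O (f x)].
Proof.
move=> Uo Oo fc; rewrite openE => x [Ux Ox].
have nO : nbhs (f x) O by exact: open_nbhs_nbhs.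
exact: filterI (open_nbhs_nbhs (conj Uo Ux)) (fc x Ux O nO).
Qed.

Lemma continuous_pair (S T T' : topologicalType) (f : S -> T) (g : S -> T') x :
  {for x, continuous f} -> {for x, continuous g} ->
  {for x, continuous (fun y => (f y, g y))}.
Proof.
move=> fc gc A [[B C] [/= /fc Bx /gc Cx] BC]; rewrite /= nbhs_simpl /=.
move: Bx Cx; rewrite /= !nbhs_simpl /= => Bx Cx.
by apply: filterS (filterI Bx Cx) => z [Bz Cz]; exact: BC.
Qed.

(** The image of the complement of [O] is compact, hence closed in [T]; its complement is the
    required [O']. *)
Lemma continuous_injective_compact_open_map (S T : topologicalType) (f : S -> T)
    (O : set S) :
  compact [set: S] -> hausdorff_space T -> continuous f -> injective f ->
  open O -> exists2 O' : set T, open O' & forall x, O' (f x) <-> O x.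
Proof.
move=> Sc Th fc fi Oo.
have Cc : compact [set f x | x in ~` O].
  apply: continuous_compact; first exact: continuous_subspaceT.
  by apply: subclosed_compact Sc _ => //; exact: open_closedC.
exists (~` [set f x | x in ~` O]).
  exact: (closed_openC (compact_closed Th Cc)).
move=> x; split => [|Ox [y Oy /fi yx]]; last by apply: Oy; rewrite yx.
by move=> H; apply: contrapT => nO; apply: H; exists x.
Qed.

Lemma hausdorff_prod (S T : topologicalType) :
  hausdorff_space S -> hausdorff_space T -> hausdorff_space (S * T)%type.
Proof.
move=> Sh Th [x y] [x' y'] H; congr (_, _).
  apply: Sh => B C Bx Cx.
  have nB : nbhs (x, y) (B `*` setT) by exists (B, setT) => //; split => //; exact: filterT.
  have nC : nbhs (x', y') (C `*` setT) by exists (C, setT) => //; split => //; exact: filterT.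
  by have [[u v] [/= [Bu _] [Cu _]]] := H _ _ nB nC; exists u.
apply: Th => B C By Cy.
have nB : nbhs (x, y) (setT `*` B) by exists (setT, B) => //; split => //; exact: filterT.
have nC : nbhs (x', y') (setT `*` C) by exists (setT, C) => //; split => //; exact: filterT.
by have [[u v] [/= [_ Bv] [_ Cv]]] := H _ _ nB nC; exists v.
Qed.

Lemma continuous_row_mx (R : realType) (T : topologicalType) (n p : nat)
    (f : T -> 'rV[R]_n) (g : T -> 'rV[R]_p) x :
  {for x, continuous f} -> {for x, continuous g} ->
  {for x, continuous (fun y => row_mx (f y) (g y))}.
Proof.
move=> fc gc; apply: continuous_rV => j; case: (splitP j) => a ja.
  have -> : j = lshift p a by apply/val_inj.
  under [X in {for _, continuous X}]eq_fun do rewrite row_mxEl.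
  apply: (@continuous_comp _ _ _ f (fun v : 'rV[R]_n => v 0 a)) => //.
  exact: coord_continuous.
have -> : j = rshift n a by apply/val_inj.
under [X in {for _, continuous X}]eq_fun do rewrite row_mxEr.
apply: (@continuous_comp _ _ _ g (fun v : 'rV[R]_p => v 0 a)) => //.
exact: coord_continuous.
Qed.

End topology_preliminaries.

(** * Continuity of complex functions through real and imaginary parts *)

Section complex_topology.
Variable R : realType.

Lemma norm_Re_le (z : R[i]) : (`|complex.Re z|%:C)%C <= `|z|.
Proof. exact: normc_ge_Re. Qed.

Lemma norm_Im_le (z : R[i]) : (`|complex.Im z|%:C)%C <= `|z|.
Proof.
case: z => a b /=; rewrite normc_def /= lecR -sqrtr_sqr ler_wsqrtr //.
by rewrite lerDr sqr_ge0.
Qed.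

Lemma norm_complex_le (z : R[i]) :
  `|z| <= ((`|complex.Re z| + `|complex.Im z|)%:C)%C.
Proof.
case: z => a b /=; rewrite normc_def /= lecR.
rewrite -[leRHS]ger0_norm ?addr_ge0 // -sqrtr_sqr ler_wsqrtr //.
by rewrite sqrrD !real_normK ?num_real // addrAC lerDl mulrn_wge0 // mulr_ge0.
Qed.

Lemma continuous_complexP (T : topologicalType) (f : T -> R[i]) x :
  {for x, continuous f} <->
  {for x, continuous (fun y => complex.Re (f y))} /\
  {for x, continuous (fun y => complex.Im (f y))}.
Proof.
split=> [fc|[rc ic]].
  split; apply/cvgrPdist_le => e e0.
    have e0' : 0 < (e%:C)%C :> R[i] by rewrite ltcR.
    have /cvgrPdist_le /(_ _ e0') := fc; apply: filterS => y H.
    by rewrite -lecR (le_trans _ H) // (le_trans _ (norm_Re_le _)) //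
      raddfB.
  have e0' : 0 < (e%:C)%C :> R[i] by rewrite ltcR.
  have /cvgrPdist_le /(_ _ e0') := fc; apply: filterS => y H.
  by rewrite -lecR (le_trans _ H) // (le_trans _ (norm_Im_le _)) // raddfB.
(* A positive element of [R[i]] has zero imaginary part, so the radius is in fact real. *)
apply/cvgrPdist_le => -[e e'] /[dup] e0.
rewrite ltcE /= => /andP[/eqP e'0 er0]; rewrite {e'}e'0 in e0 *.
have e20 : 0 < e / 2 by rewrite divr_gt0.
have /cvgrPdist_le /(_ _ e20) Hr := rc.
have /cvgrPdist_le /(_ _ e20) Hi := ic.
apply: filterS2 Hr Hi => y Hr Hi; apply: (le_trans (norm_complex_le _)).
by rewrite lecR !raddfB /= (splitr e) lerD.
Qed.

Lemma complex_eqP (z w : R[i]) :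
  complex.Re z = complex.Re w -> complex.Im z = complex.Im w -> z = w.
Proof. by case: z w => [a b] [c d] /= -> ->. Qed.

Lemma ReM (z w : R[i]) : complex.Re (z * w) =
  complex.Re z * complex.Re w - complex.Im z * complex.Im w.
Proof. by case: z w => [a b] [c d]. Qed.

Lemma ImM (z w : R[i]) : complex.Im (z * w) =
  complex.Re z * complex.Im w + complex.Im z * complex.Re w.
Proof. by case: z w => [a b] [c d]. Qed.

Lemma hausdorff_complex : hausdorff_space (R[i] : topologicalType).
Proof. exact: norm_hausdorff. Qed.

End complex_topology.

(** * The topological group G / H *)

Section quotient_group_topology.
Variables (G : topologicalZmodType) (H : zmodClosed G).
Local Notation Q := (quotient_group H).

Definition proj (x : G) : Q := (\pi_(quotient_group H) x)%qT.

Lemma projD x y : proj (x + y) = proj x + proj y.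
Proof. exact: (@Quotient.pi_add _ H). Qed.

Lemma projN x : proj (- x) = - proj x.
Proof. exact: (@Quotient.pi_opp _ H). Qed.

Lemma proj0 : proj 0 = 0.
Proof. by rewrite -[in LHS](subrr 0) projD projN subrr. Qed.

Lemma proj_eq x y : (proj x = proj y) <-> (x - y \in H).
Proof.
rewrite (Quotient.idealrBE H); split => [xy|/eqP //].
by apply/eqP; exact: xy.
Qed.

Lemma proj_surj (q : Q) : exists x, proj x = q.
Proof. by exists (repr q); rewrite /proj reprK. Qed.

Lemma proj_continuous : continuous proj.
Proof. exact: pi_continuous. Qed.

(** The saturation of [U] is the union of its translates by elements of [H], each of them open. *)
Lemma proj_open (U : set G) : open U -> open (proj @` U).
Proof.
move=> Uo; suff : open (proj @^-1` (proj @` U)) by [].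
have -> : proj @^-1` (proj @` U) =
    \bigcup_(h in [set h | h \in H]) ((fun x => x - h) @^-1` U).
  apply/seteqP; split => x /=.
    by move=> [u Uu /esym/proj_eq xu]; exists (x - u) => //=; rewrite subKr.
  by move=> [h hH /= Ux]; exists (x - h) => //; apply/proj_eq;
    rewrite addrAC subrr sub0r rpredN.
apply: bigcup_open => h _; apply: (@open_comp _ _ (fun x => x - h)) => // x _.
apply: (@continuous_comp _ _ _ (fun x => (x, h)) (fun z : G * G => z.1 - z.2)).
  by apply: continuous_pair; [exact: cvg_id|exact: cst_continuous].
exact: sub_continuous.
Qed.

Lemma proj_nbhs x (A : set G) : nbhs x A -> nbhs (proj x) (proj @` A).
Proof.
rewrite nbhsE => -[W [Wo Wx] WA].
apply: (filterS (P := proj @` W)); first exact: image_subset.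
apply: open_nbhs_nbhs; split.
  exact: proj_open.
by exists x.
Qed.

(** [quotient_group] carries a topology and a group law, but their compatibility is not part of the
    structure. It is transported from [G] because [proj] maps neighbourhoods to neighbourhoods. *)
Lemma quotient_add_continuous : continuous (fun z : Q * Q => z.1 + z.2).
Proof.
move=> [p q]; have [x <-] := proj_surj p; have [y <-] := proj_surj q.
move=> A /=; rewrite -projD => /proj_continuous Axy.
have [[B C] [/= Bx Cy] BC] := @add_continuous G (x, y) _ Axy.
exists (proj @` B, proj @` C); first by split; exact: proj_nbhs.
by move=> [_ _] /= [[u Bu <-] [v Cv <-]]; rewrite -projD; exact: (BC (u, v)).
Qed.

Lemma quotient_opp_continuous : continuous (fun q : Q => - q).
Proof.
move=> q; have [x <-] := proj_surj q.
move=> A /=; rewrite -projN => /proj_continuous Ax.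
have B := @opp_continuous G x _ Ax.
apply: (filterS _ (proj_nbhs B)) => _ [u Bu <-] /=.
by rewrite -projN.
Qed.

Lemma quotient_compact : compact [set: G] -> compact [set: Q].
Proof.
move=> Gc; have -> : [set: Q] = proj @` setT.
  by apply/seteqP; split => // q _; have [x <-] := proj_surj q; exists x.
apply: continuous_compact => //; apply: continuous_subspaceT.
exact: proj_continuous.
Qed.

(** If [x - y] is outside the closed set [H], then so is [u - v] for [u] near [x] and [v] near [y],
    which separates the images. *)
Lemma quotient_hausdorff : closed [set x : G | x \in H] -> hausdorff_space Q.
Proof.
move=> Hc p q; have [x <-] := proj_surj p; have [y <-] := proj_surj q => xy.
apply/proj_eq; apply: contrapT => nH.
have nHo : nbhs (x - y) (~` [set x : G | x \in H]).
  by apply: open_nbhs_nbhs; split; [exact: closed_openC|].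
have [[B C] [/= Bx Cy] BC] := @sub_continuous G (x, y) _ nHo.
have [_ [[u Bu <-] [v Cv /esym/proj_eq]]] := xy _ _ (proj_nbhs Bx) (proj_nbhs Cy).
exact: (BC (u, v)).
Qed.

End quotient_group_topology.
Arguments proj {G} H x.

(** * Functions of class C^k on a Lie group given by an atlas *)

Section block_row.
Variables (R : realType) (n p : nat).

Lemma lsubmx_continuous : continuous (@lsubmx R 1 n p).
Proof.
move=> w; apply: continuous_rV => j.
under [X in {for _, continuous X}]eq_fun do rewrite mxE.
exact: coord_continuous.
Qed.

Lemma rsubmx_continuous : continuous (@rsubmx R 1 n p).
Proof.
move=> w; apply: continuous_rV => j.
under [X in {for _, continuous X}]eq_fun do rewrite mxE.
exact: coord_continuous.
Qed.

Lemma open_submx_prod (U : set 'rV[R]_n) (V : set 'rV[R]_p) : open U -> open V ->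
  open [set w : 'rV[R]_(n + p) | U (lsubmx w) /\ V (rsubmx w)].
Proof.
move=> Uo Vo; apply: openI.
  by apply: (@open_comp _ _ (@lsubmx R 1 n p)) => // w _; exact: lsubmx_continuous.
by apply: (@open_comp _ _ (@rsubmx R 1 n p)) => // w _; exact: rsubmx_continuous.
Qed.

End block_row.

Section lie_groups.
Variables (R : realType) (Q : PreTopologicalZmodule.type) (n : nat).
Variable A : set (chart R Q n).
Hypothesis lieA : lie_group A.

Lemma atlas_chart c : A c -> is_chart c.
Proof. by have [_ [+ _ _] _ _] := lieA; exact. Qed.

Lemma atlas_cover x : exists2 c, A c & chart_dom c x.
Proof. by have [_ [_ + _] _ _] := lieA; exact. Qed.

Lemma chart_dom_open c : A c -> open (chart_dom c).
Proof. by move=> /atlas_chart[]. Qed.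

Lemma chart_img_open c : A c -> open (chart_img c).
Proof. by move=> /atlas_chart[]. Qed.

Lemma chart_mapK c x : A c -> chart_dom c x -> chart_inv c (chart_map c x) = x.
Proof. by move=> /atlas_chart[_ _ + _ _] => /(_ x). Qed.

Lemma chart_map_img (c : chart R Q n) x : chart_dom c x -> chart_img c (chart_map c x).
Proof. by move=> cx; exists x. Qed.

Lemma chart_inv_dom c u : A c -> chart_img c u -> chart_dom c (chart_inv c u).
Proof. by move=> Ac [x cx <-]; rewrite chart_mapK. Qed.

Lemma chart_invK c u : A c -> chart_img c u -> chart_map c (chart_inv c u) = u.
Proof. by move=> Ac [x cx <-]; rewrite chart_mapK. Qed.

(** The order [k] is kept finite because the bump functions depend on it; complex functions are
    treated by their two real components. *)
Definition Ck_function k (F : Q -> R) :=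
  forall c, A c -> Ck k (chart_img c) (fun u => F (chart_inv c u)).

Lemma Ck_function_continuous k F : Ck_function k F -> continuous F.
Proof.
move=> Fk x; have [c Ac cx] := atlas_cover x.
have [co io cK mc ic] := atlas_chart Ac.
apply: (@continuous_near_eq _ _ (chart_dom c) _
  (fun y => F (chart_inv c (chart_map c y)))) => //.
  by move=> y cy; rewrite cK.
apply: (@continuous_comp _ _ _ (chart_map c) (fun u => F (chart_inv c u))).
  exact: mc.
exact: Ck_continuous (Fk c Ac) (chart_map_img cx).
Qed.

(** Near a given pair of points the sum stays in the domain of one chart [e], so the function is [F]
    read in [e] after the addition read in the charts [c], [d], [e]. *)
Lemma Ck_function_add k F c d : Ck_function k F -> A c -> A d ->
  Ck k [set w : 'rV[R]_(n + n) | chart_img c (lsubmx w) /\ chart_img d (rsubmx w)]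
    (fun w => F (chart_inv c (lsubmx w) + chart_inv d (rsubmx w))).
Proof.
move=> Fk Ac Ad; apply: Ck_local => w [cw dw].
have [e Ae ew] := atlas_cover (chart_inv c (lsubmx w) + chart_inv d (rsubmx w)).
have [_ _ /(_ c d e Ac Ad Ae)[Wo Ws] _] := lieA.
eexists; exists (fun w => F (chart_inv e (chart_map e
  (chart_inv c (lsubmx w) + chart_inv d (rsubmx w))))); split; first exact: Wo.
- by split.
- by move=> w' [_ _ ew']; rewrite (chart_mapK Ae).
- apply: (Ck_comp (V := chart_img e) (f := fun u => F (chart_inv e u))
    (g := fun w => chart_map e (chart_inv c (lsubmx w) + chart_inv d (rsubmx w)))) => //.
  + exact: chart_img_open.
  + by move=> w' [_ _ ew']; exact: chart_map_img.
  + by move=> j; have [_] := Ws j; exact.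
  + exact: Fk.
Qed.

Lemma Ck_row_mx_cst p k (U : set 'rV[R]_n) (v : 'rV[R]_p) j :
  Ck k U (fun u => row_mx u v 0 j).
Proof.
case: (splitP j) => a ja.
  have -> : j = lshift p a by apply/val_inj.
  under [X in Ck _ _ X]eq_fun do rewrite row_mxEl.
  exact: Ck_coord.
have -> : j = rshift n a by apply/val_inj.
under [X in Ck _ _ X]eq_fun do rewrite row_mxEr.
exact: Ck_cst.
Qed.

Lemma img_prod_open c d : A c -> A d ->
  open [set w : 'rV[R]_(n + n) | chart_img c (lsubmx w) /\ chart_img d (rsubmx w)].
Proof. by move=> Ac Ad; apply: open_submx_prod; exact: chart_img_open. Qed.

(** The second block of [Ck_function_add] is frozen at the coordinates of [a] in a chart around
    [a]. *)
Lemma Ck_function_translate k F a : Ck_function k F ->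
  Ck_function k (fun q => F (q + a)).
Proof.
move=> Fk c Ac; have [d Ad da] := atlas_cover a.
apply: (Ck_eq (chart_img_open Ac) (g := fun u => F (chart_inv c
   (lsubmx (row_mx u (chart_map d a))) + chart_inv d (rsubmx (row_mx u (chart_map d a)))))).
  by move=> u cu; rewrite row_mxKl row_mxKr (chart_mapK Ad).
apply: (Ck_comp (V := [set w : 'rV[R]_(n + n) |
    chart_img c (lsubmx w) /\ chart_img d (rsubmx w)])
  (f := fun w => F (chart_inv c (lsubmx w) + chart_inv d (rsubmx w)))
  (g := fun u => row_mx u (chart_map d a))).
- exact: chart_img_open.
- exact: img_prod_open.
- by move=> u cu; split; rewrite ?row_mxKl ?row_mxKr //; exact: chart_map_img.
- by move=> j; exact: Ck_row_mx_cst.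
- exact: Ck_function_add.
Qed.

(** In a chart around 0 one takes the truncated power of [rho ^+ 2 - N], and 0 elsewhere. The
    support lies over a compact ball, so nothing goes wrong at the border of the chart domain. *)
Lemma Ck_bump k (O : set Q) : open O -> O 0 ->
  exists phi : Q -> R, [/\ Ck_function k phi, forall q, 0 <= phi q, 0 < phi 0 &
    forall q, phi q != 0 -> O q].
Proof.
move=> Oo O0; have [c Ac c0] := atlas_cover 0.
have [co io cK mc ic] := atlas_chart Ac.
pose a := chart_map c 0.
have ia : chart_img c a by exact: chart_map_img.
have Io : open [set u | chart_img c u /\ O (chart_inv c u)] by exact: open_in_preimage.
have [|r /= r0 rI] := (nbhs_ballP a _).1 (open_nbhs_nbhs (conj Io _)).
  by split => //; rewrite /a cK.
(* Half of [r], so that the closed ball [K] of radius [rho] lies in the open ball of radius [r]. *)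
pose rho := r / 2.
have rho0 : 0 < rho by rewrite divr_gt0.
(* The squared Euclidean distance to [a], a polynomial in the coordinates; the matrix norm defining
   [K] is the maximum norm, which is not differentiable. *)
pose N (u : 'rV[R]_n) := \sum_j (u 0 j - a 0 j) ^+ 2.
pose K := [set u : 'rV[R]_n | `|u - a| <= rho].
have KI u : K u -> chart_img c u /\ O (chart_inv c u).
  move=> Ku; apply: rI; rewrite -ball_normE /= distrC (le_lt_trans Ku) //.
  by rewrite /rho ltr_pdivrMr // ltr_pMr // ltr1n.
have NK u : N u < rho ^+ 2 -> K u.
  move=> Nu; apply: norm_rV_le; first exact: ltW.
  move=> j; rewrite !mxE -ler_sqr ?nnegrE ?(ltW rho0) // -normrX ger0_norm ?sqr_ge0 //.
  apply: ltW; apply: le_lt_trans Nu; rewrite /N (bigD1 j) //= lerDl.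
  by apply: sumr_ge0 => i _; exact: sqr_ge0.
have Kc : compact K.
  apply: bounded_closed_compact.
    exists (rho + `|a|); split; first exact: num_real.
    move=> M MN u Ku; apply: (le_trans _ (ltW MN)).
    rewrite -[X in `|X|](subrK a u); apply: (le_trans (ler_normD _ _)).
    by rewrite lerD2r; exact: Ku.
  have -> : K = closed_ball_ (fun x => `|x|) a rho.
    by apply/funext => u; rewrite /K /closed_ball_ /= distrC.
  exact: closed_closed_ball_.
pose phi (q : Q) : R := if pselect (chart_dom c q)
  then Num.max 0 (rho ^+ 2 - N (chart_map c q)) ^+ k.+1 else 0.
have phiP q : phi q != 0 -> chart_dom c q /\ K (chart_map c q).
  rewrite /phi; case: (pselect (chart_dom c q)) => [cq|ncq]; last by rewrite eqxx.
  have [|Nq _] := leP (rho ^+ 2 - N (chart_map c q)) 0.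
    by move=> _; rewrite expr0n /= eqxx.
  by split => //; apply: NK; rewrite -subr_gt0.
exists phi; split.
- move=> d Ad; apply: Ck_local => u du.
  have [cu|ncu] := pselect (chart_dom c (chart_inv d u)).
    have [_ [_ _ /(_ d c Ad Ac)[Wo Ws]] _ _] := lieA.
    eexists; exists (fun u => Num.max 0 (rho ^+ 2 - N (chart_map c (chart_inv d u))) ^+ k.+1).
    split; first exact: Wo.
    + by split.
    + by move=> v [dv cv]; rewrite /phi; case: pselect.
    + apply: Ck_pos_part_exp => //; apply: Ck_sub => //; first exact: Ck_cst.
      apply: Ck_sum => // j; have [_ /(_ k) Cj] := Ws j.
      have Cja := Ck_sub Wo Cj (Ck_cst k _ (a 0 j)).
      exact: (Ck_mul Wo Cja Cja).
  (* Outside the domain of [c]: the part of the group over [K] is compact, hence closed, and [phi]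
     vanishes on its open complement, which contains the point. *)
  have [Qh _ _ _] := lieA.
  have CK : compact (chart_inv c @` K).
    apply: continuous_compact => //; apply: continuous_in_subspaceT => v.
    by rewrite inE => /KI[cv _]; exact: ic.
  have [_ dio _ _ idd] := atlas_chart Ad.
  exists [set v | chart_img d v /\ (~` (chart_inv c @` K)) (chart_inv d v)], (fun=> 0).
  split.
  + apply: open_in_preimage => //; exact: (closed_openC (compact_closed Qh CK)).
  + split => // -[v /KI[cv _] vu]; apply: ncu; rewrite -vu; exact: chart_inv_dom.
  + move=> v [dv nv]; apply/eqP; apply: contrapT => /negP /phiP[cv Kv].
    by apply: nv; exists (chart_map c (chart_inv d v)) => //; rewrite cK.
  + exact: Ck_cst.
- move=> q; rewrite /phi; case: pselect => // cq.
  by apply: exprn_ge0; rewrite le_max lexx.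
- rewrite /phi; case: pselect => // cq; apply: exprn_gt0; rewrite lt_max.
  rewrite /N big1 ?subr0 ?exprn_gt0 ?orbT // => j _.
  by rewrite subrr expr0n.
- move=> q /phiP[cq /KI[_]]; by rewrite cK.
Qed.

End lie_groups.

(** * Translation invariance of the integral *)

Section haar_translation.
Variables (R : realType) (G : topologicalZmodType).
Variable lambda : {measure set (borel G) -> \bar R}.
Hypothesis lambda_translate : forall (x : G) (A : set G),
  measurable (A : set (borel G)) -> lambda [set x + y | y in A] = lambda A.

Lemma addl_continuous (x : G) : continuous (fun y => x + y).
Proof.
move=> y; apply: (@continuous_comp _ _ _ (fun y => (x, y)) (fun z : G * G => z.1 + z.2)).
  exact: continuous_pair_cst.
exact: add_continuous.
Qed.

Lemma measurable_addl (x : G) :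
  measurable_fun [set: borel G] ((fun y => x + y) : borel G -> borel G).
Proof.
apply: (@measurability _ _ _ _ _ _ (open : set (set (borel G)))) => //.
move=> _ [U Uo <-]; rewrite setTI; apply: sub_sigma_algebra.
by apply: (@open_comp _ _ (fun y => x + y)) => // y _; exact: addl_continuous.
Qed.

Lemma preimage_addl (x : G) (A : set G) :
  (fun y => x + y) @^-1` A = [set - x + y | y in A].
Proof.
apply/seteqP; split => [y Ay|_ [y Ay <-]]; last by rewrite /= addNKr.
by exists (x + y) => //; rewrite addKr.
Qed.

(** The pushforward of [lambda] by a translation is [lambda], which settles nonnegative functions;
    the positive and negative parts give the rest. *)
Lemma integral_translate (x : G) (f : borel G -> \bar R) :
  measurable_fun [set: borel G] f ->
  (\int[lambda]_y f (x + y)%R = \int[lambda]_y f y)%E.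
Proof.
have ge0 (g : borel G -> \bar R) : measurable_fun [set: borel G] g ->
    (forall y, 0 <= g y)%E -> (\int[lambda]_y g (x + y)%R = \int[lambda]_y g y)%E.
  move=> mg g0.
  have := ge0_integral_pushforward (measurable_addl x) lambda measurableT mg
    (fun y _ => g0 y).
  rewrite preimage_setT => <-.
  apply: eq_measure_integral; first exact: measurable_addl.
  move=> mphi A mA AT.
  by rewrite /= /pushforward preimage_addl lambda_translate.
move=> mf; rewrite [LHS]integralE [RHS]integralE; congr (_ - _)%E.
  rewrite -(ge0 _ (measurable_funepos mf)); last by move=> y; exact: funepos_ge0.
  by apply: eq_integral => y _; rewrite !funeposE.
rewrite -(ge0 _ (measurable_funeneg mf)); last by move=> y; exact: funeneg_ge0.
by apply: eq_integral => y _; rewrite !funenegE.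
Qed.

Hypothesis compactG : compact [set: G].
Hypothesis lambda1 : lambda [set: G] = 1%E.

Lemma mean_translate (x : G) (h : G -> R) : continuous h ->
  mean lambda (fun y => h (x + y)) = mean lambda h.
Proof.
move=> hc; rewrite /mean /Rintegral; congr fine.
apply: (integral_translate x (f := EFin \o (h : borel G -> R))).
by apply/measurable_EFinP; exact: measurable_continuous.
Qed.

(* Finitely many translates of [psi] have a positive sum, and they all have the
   same mean. *)
Lemma mean_gt0 (psi : G -> R) : continuous psi -> (forall x, 0 <= psi x) ->
  0 < psi 0 -> 0 < mean lambda psi.
Proof.
move=> pc p0 pp.
(* Any level strictly between 0 and [psi 0] would do: at every point one of the chosen translates
   exceeds it, which bounds their sum, and hence its mean, from below. *)
pose delta := psi 0 / 2.
have d0 : 0 < delta by rewrite divr_gt0.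
have tc x : continuous (fun y => psi (x + y)).
  by move=> y; apply: (@continuous_comp _ _ _ (fun y => x + y) psi);
    [exact: addl_continuous|exact: pc].
have : @cover_compact (borel G) [set: G] by rewrite -compact_cover.
move=> /(_ G setT (fun x => [set y | delta < psi (x + y)])) [].
- move=> x _; apply: (@open_comp _ _ (fun y => psi (x + y)) [set t | delta < t]).
    by move=> y _; exact: tc.
  exact: open_gt.
- move=> y _; exists (- y) => //=.
  by rewrite addNr ltr_pdivrMr // ltr_pMr // ltr1n.
move=> D _ cov.
have sumE (s : seq G) : continuous (fun y => \sum_(x <- s) psi (x + y)) /\
    mean lambda (fun y => \sum_(x <- s) psi (x + y)) = (size s)%:R * mean lambda psi.
  elim: s => [|x s [sc IH]].
    under [X in continuous X]eq_fun do rewrite big_nil.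
    under [X in mean _ X]eq_fun do rewrite big_nil.
    by split; [move=> y; exact: cst_continuous|rewrite mean_cst // mul0r].
  under [X in continuous X]eq_fun do rewrite big_cons.
  under [X in mean _ X]eq_fun do rewrite big_cons.
  split; first by move=> y; apply: cvgD; [exact: tc|exact: sc].
  by rewrite meanD // mean_translate // IH /= mulrS mulrDl mul1r.
have [sc sE] := sumE (finmap.enum_fset D).
have : delta <= (size (finmap.enum_fset D))%:R * mean lambda psi.
  rewrite -sE -[leLHS](mean_cst lambda1); apply: le_mean => //.
    by move=> y; exact: cst_continuous.
  move=> y; have [x /= xD dxy] := cov y I.
  rewrite (big_rem x) //= (le_trans (ltW dxy)) // lerDl.
  by apply: sumr_ge0.
move=> dm; have := lt_le_trans d0 dm.
case: (ltP 0 (mean lambda psi)) => // m0.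
by rewrite ltNge mulr_ge0_le0.
Qed.

End haar_translation.

(** * Continuous characters of a Lie quotient are smooth *)

Section smooth_characters.
Variables (R : realType) (G : topologicalZmodType).
Variable lambda : {measure set (borel G) -> \bar R}.
Hypothesis lambda_translate : forall (x : G) (A : set G),
  measurable (A : set (borel G)) -> lambda [set x + y | y in A] = lambda A.
Hypothesis compactG : compact [set: G].
Hypothesis lambda1 : lambda [set: G] = 1%E.
Variables (H : zmodClosed G) (n : nat) (A : set (chart R (quotient_group H) n)).
Hypothesis lieA : lie_group A.

(** This is a convolution written as an integral over [G]. Near [y] the point [proj H y] is read in
    a chart [d], and [chart_map d \o proj H] is the continuous map asked for by
    [Ck_family_local]. *)
Lemma Ck_function_mean k (phi : quotient_group H -> R) (w : G -> R) c :
  Ck_function A k phi -> continuous w -> A c ->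
  Ck k (chart_img c) (fun u => mean lambda (fun y => phi (chart_inv c u + proj H y) * w y)).
Proof.
move=> pk wc Ac; apply: (Ck_mean compactG lambda1 (chart_img_open lieA Ac) wc).
apply: (@Ck_family_local _ _ n n) => u y cu.
have [d Ad dy] := atlas_cover lieA (proj H y).
exists (chart_img c), (proj H @^-1` chart_dom d),
  [set w : 'rV[R]_(n + n) | chart_img c (lsubmx w) /\ chart_img d (rsubmx w)],
  (fun w => phi (chart_inv c (lsubmx w) + chart_inv d (rsubmx w))),
  (chart_map d \o proj H).
split.
- split => //; first exact: chart_img_open Ac.
  apply: open_comp; first by move=> *; exact: proj_continuous.
  exact: chart_dom_open Ad.
- exact: (img_prod_open lieA Ac Ad).
- move=> y' dy'; apply: continuous_comp; first exact: proj_continuous.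
  by have [_ _ _ + _] := atlas_chart lieA Ad; exact.
- move=> x' y' cx' dy'; split.
    by split; rewrite /= ?row_mxKl ?row_mxKr //; exact: chart_map_img.
  by rewrite /= row_mxKl row_mxKr (chart_mapK lieA Ad).
- exact: (Ck_function_add lieA pk Ac Ad).
Qed.

(* The convolution of [chi] with a bump function is a nonzero multiple of [chi]. *)
Lemma smooth_character (chi : quotient_group H -> R[i]) :
  continuous chi -> (forall p q, chi (p + q) = chi p * chi q) -> chi 0 = 1 ->
  smooth_function A chi.
Proof.
move=> chic chiD chi0.
have sc : continuous (fun y => chi (- proj H y)).
  move=> y; apply: (@continuous_comp _ _ _ (fun y => - proj H y) chi); last exact: chic.
  apply: (@continuous_comp _ _ _ (proj H) (fun q => - q)).
    exact: proj_continuous.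
  exact: quotient_opp_continuous.
have rc : continuous (fun y => complex.Re (chi (- proj H y))).
  by move=> y; have /continuous_complexP[] := sc y.
have ic : continuous (fun y => complex.Im (chi (- proj H y))).
  by move=> y; have /continuous_complexP[] := sc y.
(* The bump will be supported where the real part of [chi (- q)] exceeds 1 / 2, which makes the real
   part [a] of the proportionality factor positive. *)
have ocl : open [set q : quotient_group H | 1 / 2 < complex.Re (chi (- q))].
  apply: (@open_comp _ _ (fun q => complex.Re (chi (- q))) [set t | 1 / 2 < t]).
    move=> q _.
    have : {for q, continuous (fun q => chi (- q))}.
      by apply: (@continuous_comp _ _ _ (fun q : quotient_group H => - q) chi);
        [exact: quotient_opp_continuous|exact: chic].
    by move=> /continuous_complexP[].
  exact: open_gt.
suff key k : Ck_function A k (fun q => complex.Re (chi q)) /\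
    Ck_function A k (fun q => complex.Im (chi q)).
  move=> c Ac; have co := chart_img_open lieA Ac.
  by split; split => // k; have [] := key k; [move=> + _|move=> _]; exact.
have [|phi [pk p0 pp pO]] := Ck_bump lieA k ocl.
  by rewrite /= oppr0 chi0 /= ltr_pdivrMr // mul1r ltr1n.
have pc := Ck_function_continuous lieA pk.
have ppc : continuous (fun y => phi (proj H y)).
  by move=> y; apply: continuous_comp; [exact: proj_continuous|exact: pc].
have pwc (w : G -> R) : continuous w -> continuous (fun y => phi (proj H y) * w y).
  by move=> wc y; apply: cvgM; [exact: ppc|exact: wc].
(* The numbers [a + i b] and the function [P + i S] are the integral of [phi] against [chi (- y)]
   and the corresponding convolution; the aim is [P + i S = chi * (a + i b)]. *)
pose a := mean lambda (fun y => phi (proj H y) * complex.Re (chi (- proj H y))).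
pose b := mean lambda (fun y => phi (proj H y) * complex.Im (chi (- proj H y))).
pose P q := mean lambda (fun y => phi (q + proj H y) * complex.Re (chi (- proj H y))).
pose S q := mean lambda (fun y => phi (q + proj H y) * complex.Im (chi (- proj H y))).
have a0 : 0 < a.
  have h : 0 < 1 / 2 * mean lambda (fun y => phi (proj H y)).
    rewrite mulr_gt0 ?divr_gt0 //; apply: (mean_gt0 lambda_translate) => //.
    by rewrite proj0.
  apply: (lt_le_trans h); rewrite -(meanZ compactG lambda1) //; apply: (le_mean compactG lambda1) => //.
  - exact: continuous_scaler.
  - exact: pwc.
  - move=> y; rewrite mulrC; have [->|py] := eqVneq (phi (proj H y)) 0.
      by rewrite !mul0r.
    by rewrite ler_wpM2l // ltW //; exact: (pO _ py).
(* Translating the integration variable by a lift of [q] moves [q] from [phi] to the character,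
   where multiplicativity extracts it. *)
have shift (w : quotient_group H -> R) q : continuous (fun y => w (- proj H y)) ->
    mean lambda (fun y => phi (q + proj H y) * w (- proj H y)) =
    mean lambda (fun y => phi (proj H y) * w (q - proj H y)).
  move=> wc; have [x <-] := proj_surj q.
  rewrite -(mean_translate lambda_translate x (h := fun y =>
    phi (proj H y) * w (proj H x - proj H y))).
    by congr (mean _ _); apply/funext => y; rewrite projD opprD addNKr.
  have wxc : continuous (fun y => w (proj H x - proj H y)).
    have -> : (fun y => w (proj H x - proj H y)) = (fun y => w (- proj H (- x + y))).
      by apply/funext => z; rewrite projD projN opprD opprK.
    move=> y.
    apply: (@continuous_comp _ _ _ (fun y => - x + y) (fun y => w (- proj H y))).
      exact: addl_continuous.
    exact: wc.
  exact: pwc.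
have PE q : P q = complex.Re (chi q) * a - complex.Im (chi q) * b.
  rewrite /P (shift (fun q => complex.Re (chi q))) // /a /b -!(meanZ compactG lambda1); try exact: pwc.
  rewrite -(meanB compactG lambda1) //; try by apply: continuous_scaler; exact: pwc.
  by congr (mean _ _); apply/funext => y; rewrite chiD ReM mulrBr mulrCA [X in _ - X]mulrCA.
have SE q : S q = complex.Re (chi q) * b + complex.Im (chi q) * a.
  rewrite -[X in _ + X]opprK -mulNr.
  rewrite /S (shift (fun q => complex.Im (chi q))) // /a /b -!(meanZ compactG lambda1); try exact: pwc.
  rewrite -(meanB compactG lambda1) //; try by apply: continuous_scaler; exact: pwc.
  congr (mean _ _); apply/funext => y; rewrite chiD ImM mulrDr mulNr opprK.
  by rewrite mulrCA [X in _ + X]mulrCA.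
(* The next identities divide [P + i S] by [a + i b], in real coordinates. *)
have ab0 : a ^+ 2 + b ^+ 2 != 0.
  by rewrite gt_eqF // ltr_wpDr ?sqr_ge0 // exprn_gt0.
have RE q : complex.Re (chi q) = (a ^+ 2 + b ^+ 2)^-1 * (a * P q + b * S q).
  by rewrite PE SE; apply: (mulfI ab0); rewrite mulVKf //; ring.
have IE q : complex.Im (chi q) = (a ^+ 2 + b ^+ 2)^-1 * (a * S q - b * P q).
  by rewrite PE SE; apply: (mulfI ab0); rewrite mulVKf //; ring.
have Pk c : A c -> Ck k (chart_img c) (fun u => P (chart_inv c u)).
  exact: Ck_function_mean.
have Sk c : A c -> Ck k (chart_img c) (fun u => S (chart_inv c u)).
  exact: Ck_function_mean.
split=> c Ac; have co := chart_img_open lieA Ac.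
  apply: (Ck_eq co (fun u _ => RE (chart_inv c u))).
  apply: Ck_mul => //; first exact: Ck_cst.
  by apply: Ck_add => //; apply: Ck_mul => //; [exact: Ck_cst|exact: Pk|exact: Ck_cst|exact: Sk].
apply: (Ck_eq co (fun u _ => IE (chart_inv c u))).
apply: Ck_mul => //; first exact: Ck_cst.
by apply: Ck_sub => //; apply: Ck_mul => //; [exact: Ck_cst|exact: Sk|exact: Ck_cst|exact: Pk].
Qed.

End smooth_characters.

(** * Charts obtained from injective open maps *)

Section chart_of_map.
Variables (R : realType) (Q : PreTopologicalZmodule.type) (n : nat).
Variables (D : set Q) (f : Q -> 'rV[R]_n).

Definition chart_of : chart R Q n :=
  Chart D f (fun u => xget 0 [set x | D x /\ f x = u]).

Hypothesis f_inj : forall x y, D x -> D y -> f x = f y -> x = y.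

Lemma chart_ofK x : D x -> chart_inv chart_of (f x) = x.
Proof.
move=> Dx; rewrite /chart_of /=.
case: xgetP => [y _ [Dy fyx]|/(_ x)]; first exact: f_inj.
by move=> /(_ (conj Dx erefl)).
Qed.

(** Openness of [f] on the open subsets of [D] is the continuity of the chosen inverse. *)
Lemma is_chart_of : open D -> (forall x, D x -> {for x, continuous f}) ->
  (forall V, open V -> V `<=` D -> open (f @` V)) -> is_chart chart_of.
Proof.
move=> Do fc fo; split => //; first exact: fo.
  by move=> x Dx; exact: chart_ofK.
move=> u [x Dx <-] B; rewrite /= -[X in nbhs X _]/(chart_inv chart_of (f x)) chart_ofK //.
rewrite nbhsE => -[W [Wo Wx] WB].
have Vo : open (W `&` D) by exact: openI.
have fVo := fo _ Vo (@subIsetr _ _ _).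
have : nbhs (f x) (f @` (W `&` D)) by apply: open_nbhs_nbhs; split => //; exists x.
apply: filterS => _ [y [Wy Dy] <-] /=.
by rewrite -[X in B X]/(chart_inv chart_of (f y)) chart_ofK //; exact: WB.
Qed.

End chart_of_map.

(** * The Lie structure on a covering group *)

Section covering_group.
Variables (R : realType) (Q Q' : PreTopologicalZmodule.type) (n : nat).
Variable A : set (chart R Q n).
Hypothesis lieA : lie_group A.
Variable rho : Q' -> Q.
Hypothesis rho_continuous : continuous rho.
Hypothesis rho_open : forall V, open V -> open (rho @` V).
Hypothesis rhoD : forall p q, rho (p + q) = rho p + rho q.
Hypothesis rhoN : forall p, rho (- p) = - rho p.
Hypothesis add_continuous' : continuous (fun z : Q' * Q' => z.1 + z.2).
Hypothesis opp_continuous' : continuous (fun p : Q' => - p).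
Hypothesis hausdorff' : hausdorff_space Q'.
Variable V0 : set Q'.
Hypothesis V0_open : open V0.
Hypothesis V00 : V0 0.
Hypothesis rho_V0 : forall p, V0 p -> rho p = 0 -> p = 0.

(** As [V0] meets the kernel of [rho] only in 0, the condition on differences makes [rho] injective
    on [D]: such a [D] is a sheet over part of the domain of [c]. *)
Definition small_over (c : chart R Q n) (D : set Q') :=
  [/\ open D, forall p q, D p -> D q -> V0 (p - q) & forall p, D p -> chart_dom c (rho p)].

Definition covering_chart (c : chart R Q n) (D : set Q') : chart R Q' n :=
  chart_of D (fun p => chart_map c (rho p)).

Definition covering_atlas : set (chart R Q' n) :=
  [set c' | exists c D, [/\ A c, small_over c D & c' = covering_chart c D]].

Lemma small_over_inj c D p q : A c -> small_over c D -> D p -> D q ->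
  chart_map c (rho p) = chart_map c (rho q) -> p = q.
Proof.
move=> Ac [Do DV Dc] Dp Dq /(congr1 (chart_inv c)).
rewrite !(chart_mapK lieA Ac) //; try exact: Dc.
move=> pq; apply/eqP; rewrite -subr_eq0; apply/eqP; apply: rho_V0; first exact: DV.
by rewrite rhoD rhoN pq subrr.
Qed.

Lemma is_covering_chart c D : A c -> small_over c D -> is_chart (covering_chart c D).
Proof.
move=> Ac sD; have [Do DV Dc] := sD; have [co io cK mc ic] := atlas_chart lieA Ac.
apply: is_chart_of => //.
- by move=> p q Dp Dq; exact: (small_over_inj Ac sD Dp Dq).
- move=> p Dp; apply: (@continuous_comp _ _ _ rho (chart_map c)); first exact: rho_continuous.
  exact/mc/Dc.
- move=> V Vo VD.
  have -> : (fun p => chart_map c (rho p)) @` V =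
      [set u | chart_img c u /\ (rho @` V) (chart_inv c u)].
    apply/seteqP; split => [_ [p Vp <-]|_ [[x cx <-] [p Vp px]]].
      have cp : chart_dom c (rho p) by exact/Dc/VD.
      by split; [exact: chart_map_img|exists p => //; rewrite cK].
    by exists p => //; rewrite px cK.
  by apply: open_in_preimage => //; exact: rho_open.
Qed.

Lemma covering_inv c D u : A c -> small_over c D -> chart_img (covering_chart c D) u ->
  [/\ chart_img c u, D (chart_inv (covering_chart c D) u) &
      rho (chart_inv (covering_chart c D) u) = chart_inv c u].
Proof.
move=> Ac sD [p Dp <-]; have [Do DV Dc] := sD.
have -> : chart_inv (covering_chart c D) (chart_map (covering_chart c D) p) = p.
  by apply: chart_ofK => // x y; exact: small_over_inj.
have cp := Dc p Dp.
by split => //; [exact: chart_map_img|rewrite (chart_mapK lieA Ac)].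
Qed.

(** Since [rho] is a homomorphism, coordinate changes and group operations have the same expressions
    as in [Q], on smaller sets. What remains is that these sets are open and that the sheets cover
    [Q']. *)
Lemma covering_lie : lie_group covering_atlas.
Proof.
have [_ [_ _ At] Aa An] := lieA.
split => //.
- split => [_ [c [D [Ac sD ->]]]|x|_ _ [c [D [Ac sD ->]]] [d [E [Ad sE ->]]]].
  + exact: is_covering_chart.
  + have [c Ac cx] := atlas_cover lieA (rho x).
    (* Continuity of subtraction at [(x, x)] provides a neighbourhood of [x] whose differences all
       lie in [V0]. *)
    have sub_c : {for (x, x), continuous (fun z : Q' * Q' => z.1 - z.2)}.
      apply: (@continuous_comp _ _ _ (fun z : Q' * Q' => (z.1, - z.2))
        (fun z : Q' * Q' => z.1 + z.2)); last exact: add_continuous'.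
      apply: continuous_pair; first exact: cvg_fst.
      apply: (@continuous_comp _ _ _ snd (fun p : Q' => - p)); first exact: cvg_snd.
      exact: opp_continuous'.
    have V0x : nbhs (x - x) V0 by apply: open_nbhs_nbhs; rewrite subrr.
    have [[B C] [/= Bx Cx] BC] := sub_c _ V0x.
    have nBC : nbhs x (B `&` C) by exact: filterI.
    move: nBC; rewrite nbhsE => -[W [Wo Wx] WBC].
    pose D := W `&` (rho @^-1` chart_dom c).
    have sD : small_over c D.
      split.
      * apply: openI => //; apply: (@open_comp _ _ rho) => [p _|].
          exact: rho_continuous.
        exact: chart_dom_open Ac.
      * move=> p q [/WBC[Bp _] _] [/WBC[_ Cq] _]; exact: (BC (p, q)).
      * by move=> p [].
    by exists (covering_chart c D) => //; exists c, D.
  + have cc := is_covering_chart Ac sD; have [_ io _ _ ic] := cc.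
    have [Eo _ Ec] := sE.
    have Uo : open [set u | chart_img (covering_chart c D) u /\
        E (chart_inv (covering_chart c D) u)] by exact: open_in_preimage.
    have [Wo Ws] := At c d Ac Ad.
    split=> // j; split=> // k; have [_ /(_ k)] := Ws j => Wk.
    have sub : [set u | chart_img (covering_chart c D) u /\
        E (chart_inv (covering_chart c D) u)] `<=`
        [set u | chart_img c u /\ chart_dom d (chart_inv c u)].
      move=> u [cu Eu]; have [cu' _ cE] := covering_inv Ac sD cu.
      by split => //; rewrite -cE; exact: Ec.
    apply: (Ck_eq Uo _ (Ck_subset Wo sub Wk)) => u [cu Eu] /=.
    by have [_ _ ->] := covering_inv Ac sD cu.
- move=> _ _ _ [c [C [Ac sC ->]]] [d [D [Ad sD ->]]] [e [E [Ae sE ->]]].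
  have [_ cio _ _ cic] := is_covering_chart Ac sC.
  have [_ dio _ _ dic] := is_covering_chart Ad sD.
  have [Eo _ Ec] := sE.
  pose c' := covering_chart c C; pose d' := covering_chart d D.
  have Uo : open [set w : 'rV[R]_(n + n) | [/\ chart_img c' (lsubmx w),
      chart_img d' (rsubmx w) & E (chart_inv c' (lsubmx w) + chart_inv d' (rsubmx w))]].
    have -> : [set w : 'rV[R]_(n + n) | [/\ chart_img c' (lsubmx w),
      chart_img d' (rsubmx w) & E (chart_inv c' (lsubmx w) + chart_inv d' (rsubmx w))]] =
      [set w : 'rV[R]_(n + n) | (chart_img c' (lsubmx w) /\ chart_img d' (rsubmx w)) /\
        E (chart_inv c' (lsubmx w) + chart_inv d' (rsubmx w))].
      by apply/seteqP; split => w [] // [].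
    apply: open_in_preimage => //; first exact: open_submx_prod.
    move=> w [cw dw].
    apply: (@continuous_comp _ _ _
      (fun w : 'rV[R]_(n + n) => (chart_inv c' (lsubmx w), chart_inv d' (rsubmx w)))
      (fun z : Q' * Q' => z.1 + z.2)); last exact: add_continuous'.
    apply: continuous_pair.
      apply: (@continuous_comp _ _ _ (@lsubmx R 1 n n) (chart_inv c')).
        exact: lsubmx_continuous.
      exact: cic.
    apply: (@continuous_comp _ _ _ (@rsubmx R 1 n n) (chart_inv d')).
      exact: rsubmx_continuous.
    exact: dic.
  have [Wo Ws] := Aa c d e Ac Ad Ae.
  split=> // j; split=> // k; have [_ /(_ k)] := Ws j => Wk.
  apply: (Ck_eq Uo _ (Ck_subset Wo _ Wk)) => [w [cw dw Ew] /=|w [cw dw Ew] /=].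
    have [_ _ cE] := covering_inv Ac sC cw; have [_ _ dE] := covering_inv Ad sD dw.
    by rewrite rhoD cE dE.
  have [cw' _ cE] := covering_inv Ac sC cw; have [dw' _ dE] := covering_inv Ad sD dw.
  by split => //; rewrite -cE -dE -rhoD; exact: Ec.
- move=> _ _ [c [C [Ac sC ->]]] [e [E [Ae sE ->]]].
  have [_ cio _ _ cic] := is_covering_chart Ac sC.
  have [Eo _ Ec] := sE.
  pose c' := covering_chart c C.
  have Uo : open [set u | chart_img c' u /\ E (- chart_inv c' u)].
    apply: open_in_preimage => // u cu.
    apply: (@continuous_comp _ _ _ (chart_inv c') (fun p => - p)); first exact: cic.
    exact: opp_continuous'.
  have [Wo Ws] := An c e Ac Ae.
  split=> // j; split=> // k; have [_ /(_ k)] := Ws j => Wk.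
  apply: (Ck_eq Uo _ (Ck_subset Wo _ Wk)) => [u [cu Eu] /=|u [cu Eu] /=].
    by have [_ _ cE] := covering_inv Ac sC cu; rewrite rhoN cE.
  have [cu' _ cE] := covering_inv Ac sC cu.
  by split => //; rewrite -cE -rhoN; exact: Ec.
Qed.

Lemma covering_smooth F : smooth_function A F ->
  smooth_function covering_atlas (fun p => F (rho p)).
Proof.
move=> Fs _ [c [D [Ac sD ->]]].
have [_ io _ _ _] := is_covering_chart Ac sD.
have sub : chart_img (covering_chart c D) `<=` chart_img c.
  by move=> u cu; have [] := covering_inv Ac sD cu.
have co := chart_img_open lieA Ac.
have [[_ Fr] [_ Fi]] := Fs c Ac.
split; split => // k.
  apply: (Ck_eq io _ (Ck_subset co sub (Fr k))) => u cu.
  by have [_ _ ->] := covering_inv Ac sD cu.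
apply: (Ck_eq io _ (Ck_subset co sub (Fi k))) => u cu.
by have [_ _ ->] := covering_inv Ac sD cu.
Qed.

End covering_group.

(** * The circle and its Cayley coordinate *)

Section complex_circle.
Variable R : realType.

(* The Cayley coordinate, with values in R, of the circle minus the point -1. *)
Definition cayley (z : R[i]) : R := complex.Im z / (1 + complex.Re z).

(** The rational parametrisation of the circle: for [t = tan (a / 2)] it is the point of angle [a].
    Being rational, it makes smoothness a matter of sums, products and inverses. *)
Definition cayley_inv (t : R) : R[i] :=
  Complex ((1 - t ^+ 2) / (1 + t ^+ 2)) (2 * t / (1 + t ^+ 2)).

Lemma sqr_addr1_neq0 (t : R) : 1 + t ^+ 2 != 0.
Proof. by rewrite gt_eqF // ltr_pwDl // sqr_ge0. Qed.

Lemma sqr_norm_complex (z : R[i]) :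
  `|z| = 1 -> complex.Re z ^+ 2 + complex.Im z ^+ 2 = 1.
Proof.
case: z => a b; rewrite normc_def /= => -[] /(congr1 (fun x => x ^+ 2)).
by rewrite sqr_sqrtr ?expr1n // addr_ge0 // sqr_ge0.
Qed.

Lemma unit_complexP (z : R[i]) :
  complex.Re z ^+ 2 + complex.Im z ^+ 2 = 1 -> `|z| = 1.
Proof. by case: z => a b /= H; rewrite normc_def /= H sqrtr1. Qed.

Lemma Re_neq_N1 (z : R[i]) : `|z| = 1 -> z != -1 -> 1 + complex.Re z != 0.
Proof.
move=> /sqr_norm_complex zE; apply: contraNneq => z1.
have zr : complex.Re z = -1 by apply/eqP; rewrite -addr_eq0 addrC z1.
move: zE; rewrite zr sqrrN expr1n => /eqP; rewrite addrC -subr_eq0 addrK sqrf_eq0 => /eqP zi.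
by apply/eqP; apply: complex_eqP; rewrite /= ?oppr0.
Qed.

Lemma norm_cayley_inv t : `|cayley_inv t| = 1.
Proof.
apply: unit_complexP; rewrite /=; have := sqr_addr1_neq0 t => t0.
by field.
Qed.

Lemma cayley_invK t : cayley (cayley_inv t) = t.
Proof.
rewrite /cayley /=; have t0 := sqr_addr1_neq0 t.
have -> : 1 + (1 - t ^+ 2) / (1 + t ^+ 2) = 2 / (1 + t ^+ 2) by field.
by field; rewrite ?t0 ?pnatr_eq0.
Qed.

Lemma cayleyK (z : R[i]) : `|z| = 1 -> z != -1 -> cayley_inv (cayley z) = z.
Proof.
move=> z1 /(Re_neq_N1 z1); have := sqr_norm_complex z1.
case: z z1 => a b _ /= ab a1; rewrite /cayley /cayley_inv /=.
have b2 : b ^+ 2 = (1 - a) * (1 + a).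
  have -> : b ^+ 2 = 1 - a ^+ 2 by rewrite -ab; ring.
  ring.
have E : 1 + (b / (1 + a)) ^+ 2 = 2 / (1 + a).
  by rewrite expr_div_n b2; field.
have E' : 1 - (b / (1 + a)) ^+ 2 = 2 * a / (1 + a).
  by rewrite expr_div_n b2; field.
by rewrite E E'; apply: complex_eqP => /=; field; rewrite ?a1 ?pnatr_eq0.
Qed.

(** Inversion on the circle is [t |-> - t] in the Cayley coordinate; this serves for the smoothness
    of the opposite in [bundle_lie]. *)
Lemma mul_cayley_invN t : cayley_inv t * cayley_inv (- t) = 1.
Proof.
have t0 := sqr_addr1_neq0 t.
apply: complex_eqP; rewrite ?ReM ?ImM /= !sqrrN; by field.
Qed.

Section Ck_complex.
Variables (n k : nat) (U : set 'rV[R]_n).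
Hypothesis Uo : open U.

Definition Ck_complex (f : 'rV[R]_n -> R[i]) :=
  Ck k U (fun u => complex.Re (f u)) /\ Ck k U (fun u => complex.Im (f u)).

Lemma Ck_complex_cst z : Ck_complex (fun=> z).
Proof. by split; exact: Ck_cst. Qed.

Lemma Ck_complexM f g : Ck_complex f -> Ck_complex g -> Ck_complex (fun u => f u * g u).
Proof.
move=> [fr fi] [gr gi]; split.
  under [X in Ck _ _ X]eq_fun do rewrite ReM.
  by apply: Ck_sub => //; exact: Ck_mul.
under [X in Ck _ _ X]eq_fun do rewrite ImM.
by apply: Ck_add => //; exact: Ck_mul.
Qed.

Lemma Ck_cayley_inv (t : 'rV[R]_n -> R) : Ck k U t -> Ck_complex (fun u => cayley_inv (t u)).
Proof.
move=> tk; have t2 : Ck k U (fun u => t u * t u) by exact: Ck_mul.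
have ti : Ck k U (fun u => (1 + t u ^+ 2)^-1).
  apply: Ck_inv => //; first by move=> u _; exact: sqr_addr1_neq0.
  by apply: Ck_add => //; exact: Ck_cst.
split; apply: Ck_mul => //.
  by apply: Ck_sub => //; exact: Ck_cst.
by apply: Ck_mul => //; exact: Ck_cst.
Qed.

Lemma Ck_cayley f : (forall u, U u -> `|f u| = 1 /\ f u != -1) ->
  Ck_complex f -> Ck k U (fun u => cayley (f u)).
Proof.
move=> f1 [fr fi]; apply: Ck_mul => //; apply: Ck_inv => //.
  by move=> u /f1[]; exact: Re_neq_N1.
by apply: Ck_add => //; exact: Ck_cst.
Qed.

End Ck_complex.

Lemma cayley_continuous (z : R[i]) : `|z| = 1 -> z != -1 -> {for z, continuous cayley}.
Proof.
move=> z1 /(Re_neq_N1 z1) z0.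
have [rc ic] := (continuous_complexP (fun z : R[i] => z) z).1 (@cvg_id _ _).
apply: (continuousM ic); apply: continuousV => //.
by apply: continuousD => //; exact: cst_continuous.
Qed.

Lemma cayley_inv_continuous : continuous cayley_inv.
Proof.
move=> t; apply/continuous_complexP; have t0 := sqr_addr1_neq0 t.
have c2 : {for t, continuous (fun t : R => t ^+ 2)} by exact: exprn_continuous.
have ci : {for t, continuous (fun t : R => (1 + t ^+ 2)^-1)}.
  by apply: continuousV => //; apply: continuousD => //; exact: cst_continuous.
split; apply: continuousM => //.
  by apply: continuousB => //; exact: cst_continuous.
by apply: continuousM; [exact: cst_continuous|exact: cvg_id].
Qed.

End complex_circle.

(** * The Lie structure on an extension by the circle *)

Section circle_bundle.
Variables (R : realType) (Q Q' : PreTopologicalZmodule.type) (n : nat).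
Variable A : set (chart R Q n).
Hypothesis lieA : lie_group A.
Variable rho : Q' -> Q.
Hypothesis rho_continuous : continuous rho.
Hypothesis rhoD : forall p q, rho (p + q) = rho p + rho q.
Hypothesis rhoN : forall p, rho (- p) = - rho p.
Hypothesis add_continuous' : continuous (fun z : Q' * Q' => z.1 + z.2).
Hypothesis opp_continuous' : continuous (fun p : Q' => - p).
Hypothesis hausdorff' : hausdorff_space Q'.
Hypothesis compact' : compact [set: Q'].
Variable chi : Q' -> R[i].
Hypothesis chi_continuous : continuous chi.
Hypothesis chiD : forall p q, chi (p + q) = chi p * chi q.
Hypothesis chi1 : forall p, `|chi p| = 1.
Hypothesis rho_chi_inj : forall p q, rho p = rho q -> chi p = chi q -> p = q.
Hypothesis rho_chi_surj : forall q z, `|z| = 1 -> exists p, rho p = q /\ chi p = z.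

(** The Cayley coordinate misses one point of the circle, so the fibre coordinate is centred at [a];
    each point lies in the domain of a chart centred at itself. *)
Definition bundle_map (c : chart R Q n) (a : Q') (p : Q') : 'rV[R]_(n + 1) :=
  row_mx (chart_map c (rho p)) (const_mx (cayley (chi (p - a)))).

Definition bundle_dom (c : chart R Q n) (a : Q') : set Q' :=
  [set p | chart_dom c (rho p) /\ chi (p - a) != -1].

Definition bundle_chart c a := chart_of (bundle_dom c a) (bundle_map c a).

Definition bundle_atlas : set (chart R Q' (n + 1)) :=
  [set c' | exists c a, A c /\ c' = bundle_chart c a].

Lemma chi_sub_continuous a : continuous (fun p => chi (p - a)).
Proof.
move=> p; apply: (@continuous_comp _ _ _ (fun p => p - a) chi); last exact: chi_continuous.
apply: (@continuous_comp _ _ _ (fun p => (p, - a)) (fun z : Q' * Q' => z.1 + z.2)).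
  by apply: continuous_pair; [exact: cvg_id|exact: cst_continuous].
exact: add_continuous'.
Qed.

Lemma chi_0 : chi 0 = 1.
Proof.
have c0 : chi 0 != 0 by rewrite -normr_gt0 chi1.
by apply: (mulfI c0); rewrite mulr1 -chiD addr0.
Qed.

Lemma chi_subr p a : chi p = chi a * chi (p - a).
Proof. by rewrite -chiD addrC subrK. Qed.

Lemma bundle_dom_open c a : A c -> open (bundle_dom c a).
Proof.
move=> Ac.
have -> : bundle_dom c a = (rho @^-1` chart_dom c) `&`
    ((fun p => chi (p - a)) @^-1` (~` [set -1])).
  by apply/seteqP; split => p [cp /eqP].
apply: openI.
  by apply: open_comp; [move=> *; exact: rho_continuous|exact: chart_dom_open Ac].
apply: open_comp; first by move=> *; exact: chi_sub_continuous.
apply: closed_openC; apply: compact_closed; first exact: hausdorff_complex.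
exact: compact_set1.
Qed.

Lemma bundle_mapP c a p : A c -> bundle_dom c a p ->
  chart_inv c (lsubmx (bundle_map c a p)) = rho p /\
  cayley_inv (rsubmx (bundle_map c a p) 0 0) = chi (p - a).
Proof.
move=> Ac [cp pa]; rewrite /bundle_map row_mxKl row_mxKr mxE (chart_mapK lieA Ac) //.
by rewrite cayleyK.
Qed.

Lemma bundle_map_inj c a p q : A c -> bundle_dom c a p -> bundle_dom c a q ->
  bundle_map c a p = bundle_map c a q -> p = q.
Proof.
move=> Ac cp cq pq; have [p1 p2] := bundle_mapP Ac cp; have [q1 q2] := bundle_mapP Ac cq.
apply: rho_chi_inj; first by rewrite -p1 -q1 pq.
by rewrite (chi_subr p a) (chi_subr q a) -p2 -q2 pq.
Qed.

(** By compactness the pair [(rho, chi)] is an embedding, so the topology of [Q'] can be tested on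
    the product of [Q] with the complex plane. *)
Lemma rho_chi_open (V : set Q') : open V ->
  exists2 W : set (Q * R[i]), open W & forall p, W (rho p, chi p) <-> V p.
Proof.
move=> Vo; apply: (continuous_injective_compact_open_map compact') Vo.
- apply: hausdorff_prod; last exact: hausdorff_complex.
  by have [] := lieA.
- by move=> p; apply: continuous_pair; [exact: rho_continuous|exact: chi_continuous].
- by move=> p q [] rpq cpq; exact: rho_chi_inj.
Qed.

Lemma cayley_coord_continuous (a : Q') :
  continuous (fun u : 'rV[R]_(n + 1) => chi a * cayley_inv (rsubmx u 0 0)).
Proof.
have ci : continuous (fun u : 'rV[R]_(n + 1) => cayley_inv (rsubmx u 0 0)).
  move=> u.
  apply: (@continuous_comp _ _ _ (fun u : 'rV[R]_(n + 1) => rsubmx u 0 0) (@cayley_inv R)).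
    apply: (@continuous_comp _ _ _ (@rsubmx R 1 n 1) (fun v : 'rV[R]_1 => v 0 0)).
      exact: rsubmx_continuous.
    exact: coord_continuous.
  exact: cayley_inv_continuous.
move=> u; exact: (@continuousM R[i] _ (fun=> chi a) _ u (@cst_continuous _ _ _ _) (ci u)).
Qed.

Lemma is_bundle_chart c a : A c -> is_chart (bundle_chart c a).
Proof.
move=> Ac; have [co io cK mc ic] := atlas_chart lieA Ac.
apply: is_chart_of.
- by move=> p q cp cq; exact: (bundle_map_inj Ac cp cq).
- exact: bundle_dom_open.
- move=> p [cp pa]; apply: continuous_row_mx.
    by apply: (@continuous_comp _ _ _ rho (chart_map c)); [exact: rho_continuous|exact: mc].
  apply: continuous_rV => j; under [X in {for _, continuous X}]eq_fun do rewrite mxE.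
  apply: (@continuous_comp _ _ _ (fun p => chi (p - a)) (@cayley R)).
    exact: chi_sub_continuous.
  by apply: cayley_continuous.
- move=> V Vo VD; have [W Wo WV] := rho_chi_open Vo.
  (* As [(rho, chi)] reaches every pair with second component on the circle, membership in the image
     is a condition on [u] alone, and an open one. *)
  have -> : bundle_map c a @` V = [set u | (chart_img c (lsubmx u) /\ setT (rsubmx u)) /\
      W (chart_inv c (lsubmx u), chi a * cayley_inv (rsubmx u 0 0))].
    apply/seteqP; split => [_ [p Vp <-]|u [[cu _] Wu]].
      have pD := VD _ Vp; have [p1 p2] := bundle_mapP Ac pD.
      rewrite /= p1 p2 -chi_subr; split; last exact/WV.
      by split => //; rewrite /bundle_map row_mxKl; apply: chart_map_img; have [] := pD.
    have [|p [pr pc]] := rho_chi_surj (chart_inv c (lsubmx u))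
        (z := chi a * cayley_inv (rsubmx u 0 0)).
      by rewrite normrM chi1 norm_cayley_inv mulr1.
    have Vp : V p by apply/WV; rewrite pr pc.
    exists p => //; have pa : chi (p - a) = cayley_inv (rsubmx u 0 0).
      have a0 : chi a != 0 by rewrite -normr_gt0 chi1.
      by apply: (mulfI a0); rewrite -chi_subr.
    rewrite /bundle_map pr pa cayley_invK (chart_invK lieA Ac) //.
    rewrite -[RHS]hsubmxK; congr row_mx; apply/rowP => j.
    by rewrite !mxE ord1.
  apply: open_in_preimage => //.
    by apply: open_submx_prod => //; exact: openT.
  move=> u [cu _]; apply: continuous_pair; last exact: cayley_coord_continuous.
  apply: (@continuous_comp _ _ _ (@lsubmx R 1 n 1) (chart_inv c)).
    exact: lsubmx_continuous.
  exact: ic.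
Qed.

Lemma bundle_inv c a u : A c -> chart_img (bundle_chart c a) u ->
  [/\ chart_img c (lsubmx u), bundle_dom c a (chart_inv (bundle_chart c a) u),
      rho (chart_inv (bundle_chart c a) u) = chart_inv c (lsubmx u) &
      chi (chart_inv (bundle_chart c a) u) = chi a * cayley_inv (rsubmx u 0 0)].
Proof.
move=> Ac [p Dp <-].
have -> : chart_inv (bundle_chart c a) (chart_map (bundle_chart c a) p) = p.
  by apply: chart_ofK => // x y cx cy; exact: (bundle_map_inj Ac cx cy).
have [p1 p2] := bundle_mapP Ac Dp.
rewrite -[chart_map _ p]/(bundle_map c a p) p1 p2 -chi_subr; split => //.
by rewrite /bundle_map row_mxKl; apply: chart_map_img; have [] := Dp.
Qed.

(** Smoothness of a map into [Q'] is tested on its composites with [rho] and [chi]. The three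
    compatibility conditions of a Lie group are all verified in this way. *)
Lemma smooth_bundle_map m (U : set 'rV[R]_m) (h : 'rV[R]_m -> Q') d b :
  open U -> A d -> (forall u, U u -> bundle_dom d b (h u)) ->
  (forall j, smooth_on U (fun u => chart_map d (rho (h u)) 0 j)) ->
  (forall k, Ck_complex k U (fun u => chi (h u))) ->
  smooth_map_on U (fun u => bundle_map d b (h u)).
Proof.
move=> Uo Ad Ud hs hc; split => // j; split => // k; rewrite /bundle_map.
case: (splitP j) => i ij.
  have -> : j = lshift 1 i by apply/val_inj.
  under [X in Ck _ _ X]eq_fun do rewrite row_mxEl.
  by have [_] := hs i; exact.
have -> : j = rshift n i by apply/val_inj.
under [X in Ck _ _ X]eq_fun do rewrite row_mxEr mxE chiD.
apply: Ck_cayley => //.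
  move=> u /Ud[_]; rewrite chiD => ub; split => //.
  by rewrite normrM !chi1 mulr1.
by apply: Ck_complexM => //; exact: Ck_complex_cst.
Qed.

Lemma Ck_bundle_fiber m k (U : set 'rV[R]_m) (g : 'rV[R]_m -> 'rV[R]_(n + 1)) (z : R[i]) :
  open U -> (forall j, Ck k U (fun u => g u 0 j)) ->
  Ck_complex k U (fun u => z * cayley_inv (rsubmx (g u) 0 0)).
Proof.
move=> Uo gk; apply: Ck_complexM => //; first exact: Ck_complex_cst.
apply: Ck_cayley_inv => //.
by under [X in Ck _ _ X]eq_fun do rewrite mxE; exact: gk.
Qed.

Lemma Ck_complex_eq m k (U : set 'rV[R]_m) f g : open U ->
  (forall u, U u -> f u = g u) -> Ck_complex k U g -> Ck_complex k U f.
Proof.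
by move=> Uo fg [gr gi]; split; [apply: (Ck_eq Uo _ gr)|apply: (Ck_eq Uo _ gi)];
  move=> u /fg ->.
Qed.

(** The composites with [rho] are smooth because [Q] is a Lie group and [rho] a homomorphism; those
    with [chi] are products of constants and values of [cayley_inv]. *)
Lemma bundle_lie : lie_group bundle_atlas.
Proof.
have [_ [_ _ At] Aa An] := lieA.
split => //.
- split => [_ [c [a [Ac ->]]]|x|_ _ [c [a [Ac ->]]] [d [b [Ad ->]]]].
  + exact: is_bundle_chart.
  + have [c Ac cx] := atlas_cover lieA (rho x).
    exists (bundle_chart c x); first by exists c, x.
    split => //; rewrite subrr chi_0; apply/eqP => /(congr1 (@complex.Re R)) /= H.
    have : (2 : R) = 0 by lra.
    by move/eqP; rewrite pnatr_eq0.
  + have [_ io _ _ ic] := is_bundle_chart a Ac.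
    pose c' := bundle_chart c a.
    have Uo : open [set u | chart_img c' u /\ bundle_dom d b (chart_inv c' u)].
      by apply: open_in_preimage => //; exact: bundle_dom_open.
    have [Wo Ws] := At c d Ac Ad.
    apply: smooth_bundle_map => //.
    * by move=> u [].
    * move=> j; split=> // k; have [_ /(_ k)] := Ws j => Wk.
      apply: (Ck_eq Uo (g := fun u => chart_map d (chart_inv c (lsubmx u)) 0 j)).
        by move=> u [cu _]; have [_ _ -> _] := bundle_inv Ac cu.
      apply: (Ck_comp Uo Wo (g := fun u => lsubmx u)) Wk.
        move=> u [cu [du _]]; have [cu' _ cE _] := bundle_inv Ac cu.
        by split => //; rewrite -cE.
      by move=> i; under [X in Ck _ _ X]eq_fun do rewrite mxE; exact: Ck_coord.
    * move=> k; apply: (Ck_complex_eq Uo (g := fun u => chi a * cayley_inv (rsubmx u 0 0))).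
        by move=> u [cu _]; have [] := bundle_inv Ac cu.
      by apply: Ck_bundle_fiber => // j; exact: Ck_coord.
- move=> _ _ _ [c [a [Ac ->]]] [d [b [Ad ->]]] [e [f [Ae ->]]].
  have [_ cio _ _ cic] := is_bundle_chart a Ac.
  have [_ dio _ _ dic] := is_bundle_chart b Ad.
  pose c' := bundle_chart c a; pose d' := bundle_chart d b.
  pose h (w : 'rV[R]_((n + 1) + (n + 1))) := chart_inv c' (lsubmx w) + chart_inv d' (rsubmx w).
  have UE : [set w : 'rV[R]_((n + 1) + (n + 1)) | [/\ chart_img c' (lsubmx w),
      chart_img d' (rsubmx w) & bundle_dom e f (h w)]] =
      [set w : 'rV[R]_((n + 1) + (n + 1)) | (chart_img c' (lsubmx w) /\ chart_img d' (rsubmx w)) /\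
        bundle_dom e f (h w)].
    by apply/seteqP; split => w [] // [].
  have Uo : open [set w : 'rV[R]_((n + 1) + (n + 1)) | [/\ chart_img c' (lsubmx w),
      chart_img d' (rsubmx w) & bundle_dom e f (h w)]].
    rewrite UE; apply: open_in_preimage.
    + exact: open_submx_prod.
    + exact: bundle_dom_open.
    + move=> w [cw dw].
      apply: (@continuous_comp _ _ _
        (fun w : 'rV[R]_((n + 1) + (n + 1)) => (chart_inv c' (lsubmx w), chart_inv d' (rsubmx w)))
        (fun z : Q' * Q' => z.1 + z.2)); last exact: add_continuous'.
      apply: continuous_pair.
        apply: (@continuous_comp _ _ _ (@lsubmx R 1 (n + 1) (n + 1)) (chart_inv c')).
          exact: lsubmx_continuous.
        exact: cic.
      apply: (@continuous_comp _ _ _ (@rsubmx R 1 (n + 1) (n + 1)) (chart_inv d')).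
        exact: rsubmx_continuous.
      exact: dic.
  have [Wo Ws] := Aa c d e Ac Ad Ae.
  apply: (smooth_bundle_map (h := h)) => //.
  + by move=> w [].
  + move=> j; split=> // k; have [_ /(_ k)] := Ws j => Wk.
    (* Keeps the coordinates of the two points in [Q] and drops the two fibre coordinates. *)
    pose g (w : 'rV[R]_((n + 1) + (n + 1))) : 'rV[R]_(n + n) :=
      row_mx (lsubmx (lsubmx w)) (lsubmx (rsubmx w)).
    apply: (Ck_eq Uo (g := fun w => chart_map e (chart_inv c (lsubmx (g w)) +
        chart_inv d (rsubmx (g w))) 0 j)).
      move=> w [cw dw _]; rewrite /g row_mxKl row_mxKr /h rhoD.
      by have [_ _ -> _] := bundle_inv Ac cw; have [_ _ -> _] := bundle_inv Ad dw.
    apply: (Ck_comp Uo Wo (g := g)) Wk.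
      move=> w [cw dw [ew _]]; rewrite /g /= row_mxKl row_mxKr.
      have [cw' _ cE _] := bundle_inv Ac cw; have [dw' _ dE _] := bundle_inv Ad dw.
      by split => //; rewrite -cE -dE -rhoD.
    move=> i; rewrite /g; case: (splitP i) => l il.
      have -> : i = lshift n l by apply/val_inj.
      by under [X in Ck _ _ X]eq_fun do rewrite row_mxEl !mxE; exact: Ck_coord.
    have -> : i = rshift n l by apply/val_inj.
    by under [X in Ck _ _ X]eq_fun do rewrite row_mxEr !mxE; exact: Ck_coord.
  + move=> k; apply: (Ck_complex_eq Uo (g := fun w => (chi a * cayley_inv (rsubmx (lsubmx w) 0 0)) *
      (chi b * cayley_inv (rsubmx (rsubmx w) 0 0)))).
      move=> w [cw dw _]; rewrite /h chiD.
      by have [_ _ _ ->] := bundle_inv Ac cw; have [_ _ _ ->] := bundle_inv Ad dw.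
    apply: Ck_complexM => //; apply: Ck_bundle_fiber => // j;
      by under [X in Ck _ _ X]eq_fun do rewrite mxE; exact: Ck_coord.
- move=> _ _ [c [a [Ac ->]]] [e [f [Ae ->]]].
  have [_ cio _ _ cic] := is_bundle_chart a Ac.
  pose c' := bundle_chart c a.
  have Uo : open [set u | chart_img c' u /\ bundle_dom e f (- chart_inv c' u)].
    apply: open_in_preimage => //; first exact: bundle_dom_open.
    move=> u cu.
    apply: (@continuous_comp _ _ _ (chart_inv c') (fun p => - p)); first exact: cic.
    exact: opp_continuous'.
  have [Wo Ws] := An c e Ac Ae.
  apply: (smooth_bundle_map (h := fun u => - chart_inv c' u)) => //.
  + by move=> u [].
  + move=> j; split=> // k; have [_ /(_ k)] := Ws j => Wk.
    apply: (Ck_eq Uo (g := fun u => chart_map e (- chart_inv c (lsubmx u)) 0 j)).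
      by move=> u [cu _]; rewrite rhoN; have [_ _ -> _] := bundle_inv Ac cu.
    apply: (Ck_comp Uo Wo (g := fun u => lsubmx u)
      (f := fun v => chart_map e (- chart_inv c v) 0 j)) Wk.
      move=> u [cu [eu _]]; have [cu' _ cE _] := bundle_inv Ac cu.
      by split => //; rewrite -cE -rhoN.
    by move=> i; under [X in Ck _ _ X]eq_fun do rewrite mxE; exact: Ck_coord.
  (* The value of [chi] at the opposite point is its inverse, obtained by changing the sign of the
     fibre coordinate and of the centre. *)
  + move=> k; apply: (Ck_complex_eq Uo (g := fun u => chi (- a) * cayley_inv (rsubmx (- u) 0 0))).
      move=> u [cu _]; have [_ _ _ E] := bundle_inv Ac cu.
      have p0 : chi (chart_inv c' u) != 0 by rewrite -normr_gt0 chi1.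
      apply: (mulfI p0); rewrite -chiD subrr chi_0 E mulrACA -chiD subrr chi_0 mul1r.
      have -> : rsubmx (- u) 0 0 = - rsubmx u 0 0 by rewrite !mxE.
      by rewrite mul_cayley_invN.
    apply: Ck_bundle_fiber => // j.
    under [X in Ck _ _ X]eq_fun do rewrite mxE.
    by apply: Ck_opp => //; exact: Ck_coord.
Qed.

Lemma bundle_smooth F : smooth_function A F ->
  smooth_function bundle_atlas (fun p => F (rho p)).
Proof.
move=> Fs _ [c [a [Ac ->]]].
have [_ io _ _ _] := is_bundle_chart a Ac.
have co := chart_img_open lieA Ac.
have sub u : chart_img (bundle_chart c a) u -> chart_img c (lsubmx u).
  by move=> cu; have [] := bundle_inv Ac cu.
have lk k i : Ck k (chart_img (bundle_chart c a)) (fun u => lsubmx u 0 i).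
  by under [X in Ck _ _ X]eq_fun do rewrite mxE; exact: Ck_coord.
have [[_ Fr] [_ Fi]] := Fs c Ac.
split; split => // k.
  apply: (Ck_eq io _ (Ck_comp io co sub (lk k) (Fr k))) => u cu.
  by have [_ _ -> _] := bundle_inv Ac cu.
apply: (Ck_eq io _ (Ck_comp io co sub (lk k) (Fi k))) => u cu.
by have [_ _ -> _] := bundle_inv Ac cu.
Qed.

End circle_bundle.

(** * Angles on the circle *)

Section circle_angles.
Variable R : realType.

Definition circle_point (t : R) : R[i] := Complex (cos t) (sin t).

Lemma circle_pointD a b : circle_point (a + b) = circle_point a * circle_point b.
Proof.
apply: complex_eqP; rewrite ?ReM ?ImM /= ?cosD ?sinD //.
by rewrite addrC.
Qed.

Lemma circle_point0 : circle_point 0 = 1.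
Proof. by apply: complex_eqP; rewrite /= ?cos0 ?sin0. Qed.

Lemma circle_pointMn a k : circle_point (a * k%:R) = circle_point a ^+ k.
Proof.
elim: k => [|k IH]; first by rewrite mulr0 circle_point0.
by rewrite -natr1 mulrDr mulr1 circle_pointD IH exprSr.
Qed.

(** [acos] yields an angle in [0, pi] only, whence the sign. It is removed later by adding a full
    turn or by passing to the opposite group element. *)
Lemma unit_angle (z : R[i]) : `|z| = 1 ->
  exists2 t, 0 <= t <= pi & z = circle_point t \/ z = circle_point (- t).
Proof.
move=> /sqr_norm_complex; case: z => a b /= ab.
have a1 : -1 <= a <= 1.
  rewrite -ler_norml -(@ler_pXn2r _ 2) ?nnegrE // expr1n real_normK ?num_real //.
  by rewrite -ab lerDl sqr_ge0.
exists (acos a); first by rewrite acos_ge0 // acos_lepi.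
have sE : sin (acos a) = `|b|.
  by rewrite sin_acos // -ab addrAC subrr add0r sqrtr_sqr.
have cE : cos (acos a) = a by rewrite acosK // in_itv.
have [b0|b0] := leP 0 b.
  by left; apply: complex_eqP; rewrite /= ?cE ?sE ?ger0_norm.
by right; apply: complex_eqP; rewrite /= ?cosN ?cE // sinN sE ltr0_norm // opprK.
Qed.

Lemma unit_angle_ge0 (z : R[i]) : `|z| = 1 -> exists2 t, 0 <= t & z = circle_point t.
Proof.
move=> /unit_angle[t /andP[t0 tpi] [->|->]]; first by exists t.
exists (- t + pi *+ 2).
  rewrite addrC subr_ge0 (le_trans tpi) // mulr2n lerDl; exact: pi_ge0.
by apply: complex_eqP; rewrite /= ?cosD2pi ?sinD2pi.
Qed.

End circle_angles.

(** * The image of [H] under a character, and the quotient by its kernel *)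

Section subgroup_of_circle.
Variables (R : realType) (G : topologicalZmodType) (H : zmodClosed G).
Hypothesis compactG : compact [set: G].
Hypothesis closedH : closed [set x : G | x \in H].
Variable s : dual_group R G.

Lemma characterD x y : s (x + y) = s x * s y.
Proof. by have [_ + _] := characterP s; exact. Qed.

Lemma norm_character x : `|s x| = 1.
Proof. by have [_ _ +] := characterP s; exact. Qed.

Lemma character_continuous : continuous s.
Proof. by have [] := characterP s. Qed.

Lemma characterN x : s (- x) * s x = 1.
Proof. by rewrite -characterD addNr character0. Qed.

Lemma characterMn x k : s (x *+ k) = s x ^+ k.
Proof.
elim: k => [|k IH]; first by rewrite mulr0n character0.
by rewrite mulrS characterD IH exprS.
Qed.

Lemma Re_norm1_eq1 (z : R[i]) : `|z| = 1 -> 1 <= complex.Re z -> z = 1.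
Proof.
move=> /sqr_norm_complex zE z1.
have zi : complex.Im z = 0.
  apply/eqP; rewrite -sqrf_eq0 eq_le sqr_ge0 andbT.
  rewrite -(lerD2l (complex.Re z ^+ 2)) zE addr0.
  by rewrite expr_ge1 // (le_trans ler01 z1).
apply: complex_eqP => //=; apply/eqP; rewrite eq_le z1 andbT.
move: zE; rewrite zi expr0n addr0 => /eqP; rewrite sqrf_eq1 => /orP[/eqP->//|/eqP->].
lra.
Qed.

(** If 1 is not isolated in the image of [H], some values have arbitrarily small positive angles;
    their powers come close to any given point, and compactness of [H] makes the approximation
    exact. *)
Lemma circle_subgroup_dichotomy :
  (exists2 delta : R, 0 < delta &
     forall h, h \in H -> 1 - delta < complex.Re (s h) -> s h = 1) \/
  (forall z : R[i], `|z| = 1 -> exists2 h, h \in H & s h = z).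
Proof.
have [disc|ndisc] := pselect (exists2 delta : R, 0 < delta &
     forall h, h \in H -> 1 - delta < complex.Re (s h) -> s h = 1); first by left.
right=> z z1.
have small (e : R) : 0 < e -> exists h t, [/\ h \in H, 0 < t <= pi, s h = circle_point t &
    1 - e < cos t].
  move=> e0; apply: contrapT => nex; apply: ndisc; exists e => // h hH he.
  apply: contrapT => sh1; apply: nex.
  have [t /andP[t0 tpi] tE] := unit_angle (norm_character h).
  have tn0 : 0 < t.
    rewrite lt_neqAle t0 andbT; apply/eqP => t00; apply: sh1.
    by case: tE => ->; rewrite -t00 ?oppr0 circle_point0.
  case: tE => E.
    by exists h, t; split => //; [rewrite tn0|move: he; rewrite E].
  exists (- h), t; split; [by rewrite rpredN|by rewrite tn0| |by move: he; rewrite E /= cosN].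
  have h0 : s h != 0 by rewrite -normr_gt0 norm_character.
  by apply: (mulIf h0); rewrite characterN E -circle_pointD subrr circle_point0.
have [b b0 zE] := unit_angle_ge0 z1.
(* The cosine of the angle between [s h] and [z]; it is 1 exactly when they agree. *)
pose g h := complex.Re (s h * circle_point (- b)).
have approx (e : R) : 0 < e -> exists2 h, h \in H & 1 - e < g h.
  move=> /small[h [t [hH /andP[t0 tpi] sh te]]].
  (* After [k] steps of angle [t] the remainder [b - t * k] lies in [0, t), inside [0, pi], where
     the cosine decreases: its cosine is at least [cos t], hence above [1 - e]. *)
  have /truncn_itv/andP[kl ku] : 0 <= b / t by rewrite divr_ge0 // ltW.
  set k := Num.truncn _ in kl ku.
  exists (h *+ k); first by rewrite rpredMn.
  apply: (lt_le_trans te).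
  rewrite /g characterMn sh -circle_pointMn -circle_pointD /= -opprB cosN.
  have r0 : 0 <= b - t * k%:R by rewrite subr_ge0 mulrC -ler_pdivlMr.
  have rt : b - t * k%:R < t.
    by rewrite ltrBlDr -[X in X + _]mulr1 -mulrDr addrC natr1 mulrC -ltr_pdivrMr.
  rewrite leNgt ltr_cos ?in_itv /= ?r0 ?(ltW t0) ?tpi ?(le_trans (ltW rt) tpi) //.
  by rewrite -leNgt ltW.
have gc : continuous g.
  move=> h.
  have : {for h, continuous (fun h => s h * circle_point (- b))}.
    by apply: cvgM; [exact: character_continuous|exact: cst_continuous].
  by move=> /continuous_complexP[].
have Hc : compact [set h | h \in H] by apply: subclosed_compact closedH compactG _.
have H0 : [set h | h \in H] !=set0 by exists 0; exact: rpred0.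
(* The maximum of [g] on [H] is at least [1 - e] for every positive [e], and a point of the circle
   with real part at least 1 is 1. *)
have [h] := compact_EVT_max H0 Hc (continuous_subspaceT gc).
rewrite inE /= => hH hmax; exists h => //.
have g1 : 1 <= g h.
  apply/ler_addgt0Pr => e /approx[h' h'H h'e].
  have h'S : h' \in [set h | h \in H] by rewrite inE.
  by rewrite -lerBlDr (le_trans (ltW h'e)) // hmax.
have E1 : circle_point b * circle_point (- b) = 1 by rewrite -circle_pointD subrr circle_point0.
have n1 : `|circle_point (- b)| = 1.
  by apply: unit_complexP; rewrite /= cos2Dsin2.
have c0 : circle_point (- b) != 0 by rewrite -normr_gt0 n1.
apply: (mulIf c0); rewrite zE E1; apply: Re_norm1_eq1 => //.
by rewrite normrM norm_character n1 mulr1.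
Qed.

Definition character_kernel_pred : {pred G} := [pred x | (x \in H) && (s x == 1)].

Lemma character_kernel_closed : zmod_closed character_kernel_pred.
Proof.
split; first by rewrite inE rpred0 character0 eqxx.
move=> x y; rewrite !inE => /andP[xH /eqP sx] /andP[yH /eqP sy].
rewrite rpredB //= characterD sx mul1r; apply/eqP.
by have := characterN y; rewrite sy mulr1.
Qed.

Definition character_kernel : zmodClosed G :=
  HB.pack character_kernel_pred (GRing.isZmodClosed.Build G _ character_kernel_closed).

Local Notation K := character_kernel.

Lemma in_character_kernel x : (x \in K) = (x \in H) && (s x == 1).
Proof. by []. Qed.

Lemma character_kernel_is_closed : closed [set x : G | x \in K].
Proof.
have -> : [set x : G | x \in K] = [set x | x \in H] `&` (s @^-1` [set 1]).
  apply/seteqP; split => x /=; rewrite in_character_kernel; first by move=> /andP[? /eqP].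
  by move=> [-> ->]; rewrite eqxx.
apply: closedI => //; apply: closed_comp; first by move=> x _; exact: character_continuous.
by apply: compact_closed; [exact: hausdorff_complex|exact: compact_set1].
Qed.

(** This map and [to_circle] are those induced on G / K by [proj H] and [s]; [to_quotient_proj] and
    [to_circle_proj] show that the representative is immaterial. *)
Definition to_quotient (p : quotient_group K) : quotient_group H := proj H (repr p).

Definition to_circle (p : quotient_group K) : R[i] := s (repr p).

Lemma repr_proj x : repr (proj K x) - x \in K.
Proof. by apply/proj_eq; rewrite /proj reprK. Qed.

Lemma to_quotient_proj x : to_quotient (proj K x) = proj H x.
Proof. by apply/proj_eq; have /andP[] := repr_proj x. Qed.

Lemma to_circle_proj x : to_circle (proj K x) = s x.
Proof.
rewrite /to_circle -[repr _ in LHS](subrK x) characterD.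
by have /andP[_ /eqP ->] := repr_proj x; rewrite mul1r.
Qed.

Lemma to_quotient_continuous : continuous to_quotient.
Proof.
apply/quotient_continuous; rewrite (_ : _ \o _ = proj H); first exact: proj_continuous.
by apply/funext => x; exact: to_quotient_proj.
Qed.

Lemma to_circle_continuous : continuous to_circle.
Proof.
apply/quotient_continuous; rewrite (_ : _ \o _ = s); first exact: character_continuous.
by apply/funext => x; exact: to_circle_proj.
Qed.

Lemma to_quotientD p q : to_quotient (p + q) = to_quotient p + to_quotient q.
Proof.
have [x <-] := proj_surj p; have [y <-] := proj_surj q.
by rewrite -projD !to_quotient_proj projD.
Qed.

Lemma to_quotientN p : to_quotient (- p) = - to_quotient p.
Proof. by have [x <-] := proj_surj p; rewrite -projN !to_quotient_proj projN. Qed.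

Lemma to_circleD p q : to_circle (p + q) = to_circle p * to_circle q.
Proof.
have [x <-] := proj_surj p; have [y <-] := proj_surj q.
by rewrite -projD !to_circle_proj characterD.
Qed.

Lemma to_quotient_open V : open V -> open (to_quotient @` V).
Proof.
move=> Vo; have -> : to_quotient @` V = proj H @` (proj K @^-1` V).
  apply/seteqP; split => _ [p Vp <-].
    have [x xp] := proj_surj p; exists x; first by rewrite /= xp.
    by rewrite -xp to_quotient_proj.
  by exists (proj K p) => //; rewrite to_quotient_proj.
by apply: proj_open; apply: open_comp => // x _; exact: proj_continuous.
Qed.

Lemma to_quotient_circle_eq0 p : to_quotient p = 0 -> to_circle p = 1 -> p = 0.
Proof.
have [x <-] := proj_surj p; rewrite to_quotient_proj to_circle_proj -(proj0 H) => xH sx.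
rewrite -(proj0 K); apply/proj_eq; rewrite subr0 in_character_kernel sx eqxx andbT.
by have /proj_eq := xH; rewrite subr0.
Qed.

Lemma lie_character_kernel n (A : set (chart R (quotient_group H) n)) : lie_group A ->
  exists n' (A' : set (chart R (quotient_group K) n')), lie_group A' /\
    forall F, smooth_function A F -> smooth_function A' (fun p => F (to_quotient p)).
Proof.
move=> lieA.
have Kh := quotient_hausdorff character_kernel_is_closed.
have cc : continuous (fun p => complex.Re (to_circle p)).
  by move=> p; have /continuous_complexP[] := to_circle_continuous (x := p).
have [[delta d0 disc]|surj] := circle_subgroup_dichotomy.
  (* A point of [V0] over 0 comes from some [h] in [H] with the real part of [s h] above
     [1 - delta]; then [s h = 1], so the point is 0, as a covering requires. *)
  pose V0 := [set p | 1 - delta < complex.Re (to_circle p)].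
  have V0o : open V0.
    apply: (@open_comp _ _ (fun p => complex.Re (to_circle p)) [set t | 1 - delta < t]).
      by move=> p _; exact: cc.
    exact: open_gt.
  have V00 : V0 0.
    by rewrite /V0 /= -(proj0 K) to_circle_proj character0 /= ltrBlDr ltrDl.
  have V0r p : V0 p -> to_quotient p = 0 -> p = 0.
    have [x <-] := proj_surj p; rewrite /V0 /= to_circle_proj => xd p0.
    apply: to_quotient_circle_eq0 => //; rewrite to_circle_proj; apply: disc => //.
    by move: p0; rewrite to_quotient_proj -(proj0 H) => /proj_eq; rewrite subr0.
  exists n, (covering_atlas A to_quotient V0); split.
    apply: covering_lie => //.
    - exact: to_quotient_continuous.
    - exact: to_quotient_open.
    - exact: to_quotientD.
    - exact: to_quotientN.
    - exact: quotient_add_continuous.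
    - exact: quotient_opp_continuous.
  move=> F; apply: covering_smooth => //.
  - exact: to_quotient_continuous.
  - exact: to_quotient_open.
  - exact: to_quotientD.
  - exact: to_quotientN.
have inj p q : to_quotient p = to_quotient q -> to_circle p = to_circle q -> p = q.
  move=> pq cpq; apply/eqP; rewrite -subr_eq0; apply/eqP; apply: to_quotient_circle_eq0.
    by rewrite to_quotientD to_quotientN pq subrr.
  have [x xp] := proj_surj p; have [y yq] := proj_surj q.
  move: cpq; rewrite -xp -yq -projN -projD !to_circle_proj characterD => ->.
  by rewrite mulrC characterN.
(* A lift of [q] is corrected by an element of [H], which does not change its class mod [H] but can
   give [s] any value on the circle. *)
have sj q z : `|z| = 1 -> exists p, to_quotient p = q /\ to_circle p = z.
  move=> z1; have [x <-] := proj_surj q.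
  have [|h hH sh] := surj (s (- x) * z); first by rewrite normrM norm_character z1 mulr1.
  exists (proj K (x + h)); rewrite to_quotient_proj to_circle_proj; split.
    by apply/proj_eq; rewrite addrAC subrr add0r.
  by rewrite characterD sh mulrA [s x * _]mulrC characterN mul1r.
have n1 p : `|to_circle p| = 1.
  by have [x <-] := proj_surj p; rewrite to_circle_proj norm_character.
exists (n + 1)%N, (bundle_atlas A to_quotient to_circle); split.
  apply: bundle_lie => //.
  - exact: to_quotient_continuous.
  - exact: to_quotientD.
  - exact: to_quotientN.
  - exact: quotient_add_continuous.
  - exact: quotient_opp_continuous.
  - exact: quotient_compact.
  - exact: to_circle_continuous.
  - exact: to_circleD.
move=> F; apply: bundle_smooth => //.
- exact: to_quotient_continuous.
- exact: quotient_add_continuous.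
- exact: quotient_compact.
- exact: to_circle_continuous.
- exact: to_circleD.
Qed.

End subgroup_of_circle.

(** * Compactness of G *)

Section haar_compact.
Variables (R : realType) (G : topologicalZmodType).

Lemma metrizable_hausdorff (T : topologicalType) : metrizable R T -> hausdorff_space T.
Proof.
move=> [d [d0 dC dT dn]] x y xy; apply/d0.
have dge0 u v : 0 <= d u v.
  have := dT u v u; rewrite [d v u]dC (d0 u u).2 // -mulr2n pmulrn_lge0 //.
apply/eqP; rewrite eq_le dge0 andbT leNgt; apply/negP => dxy.
have e0 : 0 < d x y / 2 by rewrite divr_gt0.
have nx : nbhs x [set z | d x z < d x y / 2] by apply/dn; exists (d x y / 2).
have ny : nbhs y [set z | d y z < d x y / 2] by apply/dn; exists (d x y / 2).
have [z [/= xz yz]] := xy _ _ nx ny.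
have := dT x z y; rewrite leNgt [d z y]dC => /negP; apply.
by rewrite [X in _ < X]splitr ltrD.
Qed.

Variable lambda : {measure set (borel G) -> \bar R}.
Hypothesis lambda_haar : haar_measure lambda.
Hypothesis lambda1 : lambda [set: G] = 1%E.

Lemma haar_translate (x : G) (A : set G) :
  measurable (A : set (borel G)) -> lambda [set x + y | y in A] = lambda A.
Proof. by have [_ + _ _ _] := lambda_haar; exact. Qed.

(* If K is compact and carries more than half of the mass, K meets all its
   translates, so that G = K - K. *)
Lemma haar_compact : metrizable R G -> compact [set: G].
Proof.
move=> /metrizable_hausdorff Gh; have [_ _ _ _ inner] := lambda_haar.
(* Inner regularity of the open set G itself: otherwise its mass, the supremum of those of the
   compact sets, would be at most 1 / 2. *)
have [K Kc K2] : exists2 K : set G, compact K & ((1 / 2)%:E < lambda K)%E.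
  apply: contrapT => nK.
  have : ((1 : R)%:E <= (1 / 2)%:E)%E.
    rewrite -lambda1 (inner _ openT); apply: ge_ereal_sup => _ [K [Kc _] <-].
    by rewrite leNgt; apply/negP => K2; apply: nK; exists K.
  by rewrite lee_fin leNgt ltr_pdivrMr // mul1r ltr1n.
have mK : measurable (K : set (borel G)).
  rewrite -[K]setCK; apply: measurableC; apply: sub_sigma_algebra.
  exact: closed_openC (compact_closed Gh Kc).
have -> : [set: G] = (fun z : G * G => z.1 - z.2) @` (K `*` K).
  apply/seteqP; split => // x _.
  have xKc : compact [set x + y | y in K].
    by apply: continuous_compact => //; apply: continuous_subspaceT; exact: addl_continuous.
  have mxK : measurable ([set x + y | y in K] : set (borel G)).
    rewrite -[X in measurable X]setCK; apply: measurableC; apply: sub_sigma_algebra.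
    exact: closed_openC (compact_closed Gh xKc).
  have [[_ [[y Ky <-] xyK]]|nI] := pselect (exists z, [set x + y | y in K] z /\ K z).
    by exists (x + y, y) => //=; rewrite addrK.
  have I0 : [set x + y | y in K] `&` K = set0.
    by apply/seteqP; split => // z [xz Kz]; apply: nI; exists z.
  have UE : (lambda ([set (x + y)%R | y in K] `|` K) = lambda K + lambda K)%E.
    apply: (eq_trans (measureU lambda mxK mK I0)); congr (_ + _)%E.
    exact: haar_translate.
  have : (lambda K + lambda K <= 1)%E.
    rewrite -UE -lambda1; apply: le_measure => //; apply: mem_set.
      exact: (measurableU _ _ mxK mK).
    exact: (@measurableT _ (borel G)).
  rewrite leNgt => /negP[].
  have -> : 1%E = ((1 / 2)%:E + (1 / 2)%:E : \bar R)%E by rewrite -EFinD -splitr.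
  exact: lteD.
apply: continuous_compact; last exact: compact_setX.
by apply: continuous_subspaceT; exact: sub_continuous.
Qed.

End haar_compact.

(** * Reindexing and rescaling of unordered sums *)

Section unordered_sums.
Variable R : realType.

Lemma cvg_mull_complex (T : Type) (F : set_system T) (FF : Filter F)
    (f : T -> R[i]) (c l : R[i]) :
  f @ F --> l -> (fun x => c * f x) @ F --> c * l.
Proof.
have mc : {for l, continuous (fun z : R[i] => c * z)}.
  exact: (@continuousM R[i] _ (fun=> c) (fun z => z) l (@cst_continuous _ _ _ _) (@cvg_id _ _)).
by move=> fl; exact: (cvg_comp f (fun z => c * z) fl mc).
Qed.

Lemma partial_sum_shift (I : zmodType) (F : I -> R[i]) (a : I) (J : {fset I}) :
  summability.partial_sum (fun i => F (i + a)) J =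
  summability.partial_sum F [fset (i + a)%R | i in J]%fset.
Proof.
rewrite /summability.partial_sum -(big_seq_fsetE _ _ predT F).
rewrite -(big_seq_fsetE _ _ predT (fun i => F (i + a))) big_imfset //=.
by move=> i j _ _; exact: addIr.
Qed.

(** A shift of the indices permutes the finite sets and respects inclusion, so the two image filters
    are equal; their limits agree even when neither sum converges. *)
Lemma sum_shift (I : zmodType) (F : I -> R[i]) (a : I) :
  summability.sum (fun i => F (i + a)) = summability.sum F.
Proof.
have sub (f : I -> R[i]) (b : I) (P : set R[i]) :
    (summability.partial_sum f @ summability.totally) P ->
    (summability.partial_sum (fun i => f (i + b)) @ summability.totally) P.
  move=> [A _ AP]; exists [fset (i - b)%R | i in A]%fset => // J /= AJ.
  rewrite partial_sum_shift; apply: AP => /=; apply/fsubsetP => i iA.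
  apply/imfsetP; exists (i - b); last by rewrite subrK.
  by apply: (fsubsetP AJ); apply/imfsetP; exists i.
rewrite /summability.sum; congr (lim _); apply/seteqP; split => P; last exact: sub.
have -> : summability.partial_sum F =
    summability.partial_sum (fun i => (fun i => F (i + a)) (i - a)).
  by congr summability.partial_sum; apply/funext => i; rewrite subrK.
exact: sub.
Qed.

(** Multiplying by [c^-1] shows that one family is summable only if the other is; when neither is,
    both sums take the default value [point], which is 0. *)
Lemma sum_scale (I : choiceType) (F : I -> R[i]) (c : R[i]) : c != 0 ->
  summability.sum (fun i => c * F i) = c * summability.sum F.
Proof.
move=> c0; have totally_filter := @summability.totally_filter I.
have E (d : R[i]) (f : I -> R[i]) : summability.partial_sum (fun i => d * f i) =
    (fun J => d * summability.partial_sum f J).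
  by apply/funext => J; rewrite /summability.partial_sum mulr_sumr.
have cvgZ (d l : R[i]) (f : I -> R[i]) :
    summability.partial_sum f @ summability.totally --> l ->
    summability.partial_sum (fun i => d * f i) @ summability.totally --> d * l.
  by move=> Fl; rewrite E; exact: cvg_mull_complex Fl.
have [/cvg_ex[l Fl]|nF] := pselect (cvg (summability.partial_sum F @ summability.totally)).
  rewrite /summability.sum (cvg_lim (@hausdorff_complex R) Fl).
  exact: (cvg_lim (@hausdorff_complex R) (cvgZ c l F Fl)).
have ncF : ~ cvg (summability.partial_sum (fun i => c * F i) @ summability.totally).
  move=> /cvg_ex[l cFl]; apply: nF; apply/cvg_ex; exists (c^-1 * l).
  have := cvgZ c^-1 l _ cFl; rewrite (_ : (fun i => c^-1 * (c * F i)) = F) //.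
  by apply/funext => i; rewrite mulKf.
rewrite /summability.sum (dvgP nF) (dvgP ncF).
by rewrite (_ : point = 0 :> R[i]) ?mulr0.
Qed.

End unordered_sums.

(** * Invariance of the small Lebesgue norms *)

Section small_norm_invariance.
Variables (R : realType) (G : topologicalZmodType).
Variable lambda : {measure set (borel G) -> \bar R}.
Hypothesis lambda_translate : forall (x : G) (A : set G),
  measurable (A : set (borel G)) -> lambda [set x + y | y in A] = lambda A.
Variables p theta : R.
Implicit Types (g : G -> R[i]) (a : G) (s : dual_group R G).

Lemma Re_normE (z : R[i]) :
  complex.Re `|z| = Num.sqrt (complex.Re z ^+ 2 + complex.Im z ^+ 2).
Proof. by case: z => x y; rewrite normc_def. Qed.

Lemma measurable_Re_norm g : cmeasurable g ->
  measurable_fun [set: borel G] ((fun x => complex.Re `|g x|) : borel G -> R).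
Proof.
move=> [gr gi].
have -> : (fun x : borel G => complex.Re `|g x|) =
    Num.sqrt \o (fun x : borel G => complex.Re (g x) ^+ 2 + complex.Im (g x) ^+ 2).
  by apply/funext => x; rewrite Re_normE.
apply: measurableT_comp; first exact: continuous_measurable_fun (@sqrt_continuous R).
by apply: measurable_funD; exact: measurable_funX.
Qed.

Lemma Lnorm_translate a (q : R) (f : borel G -> \bar R) :
  measurable_fun [set: borel G] f ->
  Lnorm lambda q%:E (fun x => f (a + x)%R) = Lnorm lambda q%:E f.
Proof.
move=> mf; rewrite unlock; congr (_ `^ _)%E.
apply: (integral_translate lambda_translate a (f := fun x => (`|f x| `^ q)%E)).
apply: (measurableT_comp (measurable_poweR _)).
exact: measurableT_comp.
Qed.

Lemma small_term_translate a g : cmeasurable g ->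
  small_term lambda p theta (fun x => g (a + x)) = small_term lambda p theta g.
Proof.
move=> mg; rewrite /small_term; congr ereal_inf.
apply: eq_imagel => eps _; congr (_ * _)%E.
apply: (Lnorm_translate a _ (f := fun x : borel G => (complex.Re `|g x|)%:E)).
by apply/measurable_EFinP; exact: measurable_Re_norm.
Qed.

Lemma cmeasurable_translate a g : cmeasurable g -> cmeasurable (fun x => g (a + x)).
Proof.
by move=> [gr gi]; split;
  [exact: (measurableT_comp gr (measurable_addl a))
  |exact: (measurableT_comp gi (measurable_addl a))].
Qed.

Lemma ae_translate a (P : G -> Prop) :
  {ae lambda, forall x : borel G, P x} -> {ae lambda, forall x : borel G, P (a + x)}.
Proof.
move=> [N [mN N0 PN]]; exists ((fun y => a + y) @^-1` N); split.
- by have := measurable_addl a measurableT mN; rewrite setTI.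
- by rewrite preimage_addl lambda_translate.
- by move=> x nP; exact: PN.
Qed.

(** Translating a decomposition of [g] gives one of the translate with the same terms in the sum,
    the exceptional null set being translated too. The opposite translation gives the reverse
    inequality. *)
Lemma small_norm_translate_le a g :
  (small_norm lambda p theta (fun x => g (a + x)%R) <= small_norm lambda p theta g)%E.
Proof.
apply: ereal_inf_le_tmp => _ [gs [mgs aeg] <-].
exists (fun k x => gs k (a + x)).
  split; first by move=> k; exact: cmeasurable_translate.
  exact: (@ae_translate a (fun x =>
    (fun N : nat => \sum_(0 <= k < N) gs k x) @ \oo --> g x) aeg).
by apply: eq_eseriesr => k _; exact: small_term_translate.
Qed.

Lemma small_norm_translate a g :
  small_norm lambda p theta (fun x => g (a + x)) = small_norm lambda p theta g.
Proof.
apply/eqP; rewrite eq_le; apply/andP; split; first exact: small_norm_translate_le.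
have {1}-> : g = (fun x => (fun y => g (a + y)) (- a + x)).
  by apply/funext => x; rewrite addNKr.
exact: small_norm_translate_le.
Qed.

Lemma small_term_character s g :
  small_term lambda p theta (fun x => s x * g x) = small_term lambda p theta g.
Proof.
rewrite /small_term; congr ereal_inf; apply: eq_imagel => eps _; congr (_ * Lnorm _ _ _)%E.
by apply/funext => x; rewrite normrM norm_character mul1r.
Qed.

Lemma measurable_character s : cmeasurable s.
Proof.
have sc := @character_continuous R G s.
by split; apply: measurable_continuous => x; have /continuous_complexP[] := sc x.
Qed.

Lemma cmeasurable_character s g : cmeasurable g -> cmeasurable (fun x => s x * g x).
Proof.
move=> [gr gi]; have [sr si] := measurable_character s; split.
  under eq_fun do rewrite ReM.
  by apply: measurable_funB; exact: measurable_funM.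
under eq_fun do rewrite ImM.
by apply: measurable_funD; exact: measurable_funM.
Qed.

(** Multiplying every member of a decomposition by [s] leaves all moduli unchanged; [- s] gives the
    reverse inequality. *)
Lemma small_norm_character_le s g :
  (small_norm lambda p theta (fun x => s x * g x)%R <= small_norm lambda p theta g)%E.
Proof.
apply: ereal_inf_le_tmp => _ [gs [mgs aeg] <-].
exists (fun k x => s x * gs k x).
  split; first by move=> k; exact: cmeasurable_character.
  apply: filterS aeg => x gx.
  under eq_fun do rewrite -mulr_sumr.
  exact: cvg_mull_complex gx.
by apply: eq_eseriesr => k _; exact: small_term_character.
Qed.

Lemma small_norm_character s g :
  small_norm lambda p theta (fun x => s x * g x) = small_norm lambda p theta g.
Proof.
apply/eqP; rewrite eq_le; apply/andP; split; first exact: small_norm_character_le.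
have := small_norm_character_le (- s) (fun x => s x * g x).
rewrite (_ : (fun x => (- s) x * (s x * g x)) = g) //.
by apply/funext => x; rewrite mulrA (characterN s) mul1r.
Qed.

End small_norm_invariance.

(** * Bruhat smooth functions, Fourier coefficients and multipliers *)

Section bruhat_smooth_functions.
Variables (R : realType) (G : topologicalZmodType).
Variable lambda : {measure set (borel G) -> \bar R}.
Hypothesis lambda_translate : forall (x : G) (A : set G),
  measurable (A : set (borel G)) -> lambda [set x + y | y in A] = lambda A.
Hypothesis compactG : compact [set: G].
Hypothesis lambda1 : lambda [set: G] = 1%E.

Lemma smooth_functionP (Q : PreTopologicalZmodule.type) n (A : set (chart R Q n))
    (F : Q -> R[i]) : lie_group A -> smooth_function A F <->
  forall k, Ck_function A k (fun q => complex.Re (F q)) /\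
            Ck_function A k (fun q => complex.Im (F q)).
Proof.
move=> lieA; split=> [Fs k|Fk c Ac].
  by split=> c Ac; have [[_ Fr] [_ Fi]] := Fs c Ac.
have co := chart_img_open lieA Ac.
by split; split => // k; [exact: (Fk k).1|exact: (Fk k).2].
Qed.

Lemma smooth_functionM (Q : PreTopologicalZmodule.type) n (A : set (chart R Q n))
    (E F : Q -> R[i]) : lie_group A -> smooth_function A E -> smooth_function A F ->
  smooth_function A (fun q => E q * F q).
Proof.
move=> lieA /(smooth_functionP _ lieA) Es /(smooth_functionP _ lieA) Fs.
apply/(smooth_functionP _ lieA) => k; have [Er Ei] := Es k; have [Fr Fi] := Fs k.
split=> c Ac; have co := chart_img_open lieA Ac.
  under [X in Ck _ _ X]eq_fun do rewrite ReM.
  by apply: Ck_sub => //; apply: Ck_mul => //; [exact: Er|exact: Fr|exact: Ei|exact: Fi].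
under [X in Ck _ _ X]eq_fun do rewrite ImM.
by apply: Ck_add => //; apply: Ck_mul => //; [exact: Er|exact: Fi|exact: Ei|exact: Fr].
Qed.

Lemma bruhat_smooth_continuous (f : G -> R[i]) : bruhat_smooth f -> continuous f.
Proof.
move=> [H [Hc [n [A [lieA [F [/(smooth_functionP _ lieA) Fs fF]]]]]]] x.
have [Fr Fi] := Fs 0%N.
have Fc : continuous F.
  move=> q; apply/continuous_complexP.
  by split; [exact: (Ck_function_continuous lieA Fr)|exact: (Ck_function_continuous lieA Fi)].
have -> : f = F \o proj H by apply/funext => y; exact: fF.
by apply: continuous_comp; [exact: proj_continuous|exact: Fc].
Qed.

(** The same subgroup [H] serves: translation by [a] descends to translation by [proj H a]. *)
Lemma bruhat_smooth_translate (f : G -> R[i]) a :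
  bruhat_smooth f -> bruhat_smooth (fun x => f (a + x)).
Proof.
move=> [H [Hc [n [A [lieA [F [/(smooth_functionP _ lieA) Fs fF]]]]]]].
exists H; split => //; exists n, A; split => //.
exists (fun q => F (q + proj H a)); split.
  apply/(smooth_functionP _ lieA) => k; have [Fr Fi] := Fs k.
  by split; [exact: (Ck_function_translate lieA _ Fr)|exact: (Ck_function_translate lieA _ Fi)].
by move=> x; rewrite fF addrC -[in LHS]/(proj H _) projD.
Qed.

(** On G / K the function [s] becomes [to_circle], a continuous character of a Lie group and
    therefore smooth, while [f] stays smooth after pullback along [to_quotient]. *)
Lemma bruhat_smooth_character (f : G -> R[i]) (s : dual_group R G) :
  bruhat_smooth f -> bruhat_smooth (fun x => s x * f x).
Proof.
move=> [H [Hc [n [A [lieA [F [Fs fF]]]]]]].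
exists (character_kernel H s); split; first exact: character_kernel_is_closed.
have [n' [A' [lieA' A'F]]] := lie_character_kernel compactG Hc s lieA.
exists n', A'; split => //.
exists (fun p => to_circle p * F (to_quotient p)); split.
  apply: smooth_functionM => //; last exact: A'F.
  apply: (smooth_character lambda_translate compactG lambda1 lieA').
  - exact: to_circle_continuous.
  - exact: to_circleD.
  - by rewrite -(proj0 (character_kernel H s)) to_circle_proj character0.
move=> x; rewrite fF.
by rewrite -[X in to_circle X]/(proj (character_kernel H s) x) to_circle_proj to_quotient_proj.
Qed.

Lemma fourier_translate (f : G -> R[i]) a (s : dual_group R G) : continuous f ->
  fourier lambda (fun x => f (a + x)) s = s a * fourier lambda f s.
Proof.
move=> fc.
pose g x := f x * s (- x).
have gc : continuous g.
  move=> x; apply: cvgM; first exact: fc.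
  apply: (@continuous_comp _ _ _ (fun x => - x) s); first exact: opp_continuous.
  exact: character_continuous.
have rc : continuous (fun x => complex.Re (g x)) by move=> x; have /continuous_complexP[] := gc x.
have ic : continuous (fun x => complex.Im (g x)) by move=> x; have /continuous_complexP[] := gc x.
(* The integrand is [s a] times the translate of [g], so translation invariance applies to [g] as a
   whole. *)
have E x : f (a + x) * s (- x) = s a * g (a + x).
  rewrite /g mulrCA; congr (_ * _); rewrite -characterD; congr (s _).
  by rewrite opprD addNKr.
have tc (h : G -> R) : continuous h -> continuous (fun x => h (a + x)).
  move=> hc x; apply: (@continuous_comp _ _ _ (fun x => a + x) h).
    exact: addl_continuous.
  exact: hc.
rewrite /fourier /cintegral; under eq_fun do rewrite E ReM.
under [X in Complex _ (Rintegral _ _ X)]eq_fun do rewrite E ImM.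
have scl (c : R) (h : G -> R) : continuous h -> continuous (fun x => c * h x).
  exact: continuous_scaler.
apply: complex_eqP; rewrite ?ReM ?ImM /= -!/(mean _ _).
  rewrite (meanB compactG lambda1 (scl _ _ (tc _ rc)) (scl _ _ (tc _ ic))).
  rewrite (meanZ compactG lambda1 _ (tc _ rc)) (meanZ compactG lambda1 _ (tc _ ic)).
  by rewrite (mean_translate lambda_translate a rc) (mean_translate lambda_translate a ic).
rewrite (meanD compactG lambda1 (scl _ _ (tc _ ic)) (scl _ _ (tc _ rc))).
rewrite (meanZ compactG lambda1 _ (tc _ rc)) (meanZ compactG lambda1 _ (tc _ ic)).
by rewrite (mean_translate lambda_translate a rc) (mean_translate lambda_translate a ic).
Qed.

Lemma fourier_character (f : G -> R[i]) (s t : dual_group R G) :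
  fourier lambda (fun x => s x * f x) t = fourier lambda f (t - s).
Proof.
rewrite /fourier; congr cintegral; apply/funext => x.
by rewrite -[(t - s) (- x)]/(t (- x) * s (- - x)) opprK; ring.
Qed.

(** A translation of [f] by [a] multiplies its Fourier coefficient at [s] by [s a], a factor that
    can be moved into the multiplier. *)
Lemma bilinear_op_modulate (m : dual_group R G -> dual_group R G -> R[i]) a b f g :
  continuous f -> continuous g ->
  bilinear_op lambda (modulate2 b (modulate1 a m)) f g =
  bilinear_op lambda m (fun x => f (a + x)) (fun x => g (b + x)).
Proof.
move=> fc gc; apply/funext => x; rewrite /bilinear_op.
congr summability.sum; apply/funext => s; congr summability.sum; apply/funext => t.
rewrite !fourier_translate // /modulate2 /modulate1; ring.
Qed.

(** Substituting [s + s0] and [t + t0] restores [m], turns the Fourier coefficients into those of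
    the functions multiplied by [- s0] and [- t0], and leaves the factor [(s0 + t0) x] in front. *)
Lemma bilinear_op_translate (m : dual_group R G -> dual_group R G -> R[i]) s0 t0 f g :
  bilinear_op lambda (translate s0 t0 m) f g =
  (fun x => (s0 + t0) x * bilinear_op lambda m (fun x => (- s0) x * f x)
    (fun x => (- t0) x * g x) x).
Proof.
apply/funext => x; rewrite /bilinear_op.
have n0 : (s0 + t0) x != 0 by rewrite -normr_gt0 norm_character.
rewrite -sum_scale // -(sum_shift _ s0).
congr summability.sum; apply/funext => s; rewrite -sum_scale // -(sum_shift _ t0).
congr summability.sum; apply/funext => t.
rewrite !fourier_character !opprK /translate !addrK.
have -> : (s + s0 + (t + t0)) x = (s0 + t0) x * (s + t) x by rewrite /=; ring.
ring.
Qed.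

Variables theta p1 p2 p3 : R.
Implicit Type m : dual_group R G -> dual_group R G -> R[i].

Lemma multiplier_bound_translate m s0 t0 C :
  multiplier_bound lambda theta p1 p2 p3 m C ->
  multiplier_bound lambda theta p1 p2 p3 (translate s0 t0 m) C.
Proof.
move=> mC f g fs gs; rewrite bilinear_op_translate small_norm_character.
have := mC _ _ (bruhat_smooth_character (- s0) fs) (bruhat_smooth_character (- t0) gs).
by rewrite !small_norm_character.
Qed.

Lemma multiplier_bound_modulate m a b C :
  multiplier_bound lambda theta p1 p2 p3 m C ->
  multiplier_bound lambda theta p1 p2 p3 (modulate2 b (modulate1 a m)) C.
Proof.
move=> mC f g fs gs.
rewrite bilinear_op_modulate; try exact: bruhat_smooth_continuous.
have := mC _ _ (bruhat_smooth_translate a fs) (bruhat_smooth_translate b gs).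
by rewrite !(small_norm_translate lambda_translate).
Qed.

Lemma translateK m s0 t0 : translate (- s0) (- t0) (translate s0 t0 m) = m.
Proof.
by apply/funext => s; apply/funext => t; rewrite /translate !opprK !addrK.
Qed.

Lemma modulateK m a b :
  modulate2 (- b) (modulate1 (- a) (modulate2 b (modulate1 a m))) = m.
Proof.
apply/funext => s; apply/funext => t; rewrite /modulate2 /modulate1.
have -> : t (- b) * (s (- a) * (t b * (s a * m s t))) =
    (t (- b) * t b) * ((s (- a) * s a) * m s t) by ring.
by rewrite !characterN !mul1r.
Qed.

(** The norm is the infimum of the admissible constants, so the equality of norms follows from that
    of the two sets of constants. *)
Lemma BM_invariant m m' :
  (exists M : R, forall s t, complex.Re `|m' s t| <= M) ->
  (forall C, multiplier_bound lambda theta p1 p2 p3 m C <->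
             multiplier_bound lambda theta p1 p2 p3 m' C) ->
  BM lambda theta p1 p2 p3 m ->
  BM lambda theta p1 p2 p3 m' /\
  BM_norm lambda theta p1 p2 p3 m' = BM_norm lambda theta p1 p2 p3 m.
Proof.
move=> m'M mm' [_ [C C0 mC]]; split.
  by split; [exact: m'M|exists C; [exact: C0|exact: (mm' C).1 mC]].
have inf_eq (P P' : R -> Prop) : (forall C, P C <-> P' C) ->
    inf [set C : R | 0 < C /\ P' C] = inf [set C : R | 0 < C /\ P C].
  move=> PP'; congr inf; apply/seteqP; split => D [D0 PD]; split => //; exact/PP'.
exact: (inf_eq _ _ mm').
Qed.

End bruhat_smooth_functions.

Theorem theorem2 (R : realType) (G : topologicalZmodType)
    (G_metric : metrizable R G) (G_lc : locally_compact [set: G])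
    (lambda : {measure set (borel G) -> \bar R})
    (lambda_haar : haar_measure lambda)
    (lambda_normalized : lambda [set: G] = 1%E)
    (p1 p2 p3 theta : R)
    (p1_gt1 : 1 < p1) (p2_gt1 : 1 < p2) (p3_gt1 : 1 < p3)
    (theta_ge0 : 0 <= theta)
    (m : dual_group R G -> dual_group R G -> R[i])
    (m_BM : BM lambda theta p1 p2 p3 m) :
  (forall s0 t0 : dual_group R G,
     BM lambda theta p1 p2 p3 (translate s0 t0 m) /\
     BM_norm lambda theta p1 p2 p3 (translate s0 t0 m) =
       BM_norm lambda theta p1 p2 p3 m) /\
  (forall s0 t0 : G,
     BM lambda theta p1 p2 p3 (modulate2 t0 (modulate1 s0 m)) /\
     BM_norm lambda theta p1 p2 p3 (modulate2 t0 (modulate1 s0 m)) =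
       BM_norm lambda theta p1 p2 p3 m).
Proof.
have Gc := haar_compact lambda_haar lambda_normalized G_metric.
have lt := haar_translate lambda_haar.
have [[M mM] _] := m_BM.
split=> s0 t0; apply: BM_invariant m_BM.
- by exists M => s t; exact: mM.
- move=> C; split; first exact: multiplier_bound_translate.
  (* The converse is the same implication with the opposite parameters, which undo the
     translation. *)
  move=> /(multiplier_bound_translate lt Gc lambda_normalized (- s0) (- t0)).
  by rewrite translateK.
- exists M => s t; rewrite /modulate2 /modulate1 !normrM !norm_character !mul1r.
  exact: mM.
- move=> C; split; first exact: multiplier_bound_modulate.
  move=> /(multiplier_bound_modulate lt Gc lambda_normalized (- s0) (- t0)).
  by rewrite modulateK.
Qed.
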